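(* Let $n\in\mathbb{N}$. (a) The polynomials $\{\Pi b_{n,2k}:0\le k\le \frac{n-1}{3}\}$ are linearly independent. (b) The set $\{RM\Pi b_{n,2k},\ MR\Pi b_{n,2k}: 0\le k\le\frac{n-1}{3}\}$ is linearly independent and is a basis of the $\tau_{\mathrm{refl}}$ component of $\mathbb{P}^\perp_{n,n-1}(\widehat T)$.
   Context: $\widehat T$ is the triangle with vertices $(0,0),(1,0),(0,1)$; $\mathbb{P}^\perp_{n,n-1}(\widehat T)$ is the space of polynomials of total degree $\le n$ that are $L^2(\widehat T)$-orthogonal to all polynomials of degree $\le n-1$. With Jacobi polynomials $P_m^{(\alpha,\beta)}$ ($P_m^{(\alpha,\beta)}(1)=(\alpha+1)_m/m!$) and Legendre polynomials $P^{(0,0)}_k$, $b_{n,k}(x_1,x_2):=(x_1+x_2)^kP^{(0,2k+1)}_{n-k}(2(x_1+x_2)-1)P^{(0,0)}_k\!\left(\frac{x_1-x_2}{x_1+x_2}\right)$, $0\le k\le n$. Linear maps: $Mp(x_1,x_2):=p(1-x_1-x_2,x_2)$, $Rp(x_1,x_2):=p(x_2,x_1)$ (with $RM,MR$ operator compositions; $M$ and $R$ generate an action of the symmetric group $\mathcal{S}_3$ on $\mathbb{P}^\perp_{n,n-1}(\widehat T)$), and $\Pi:=\frac13(2I-MR-RM)$. The $\tau_{\mathrm{refl}}$ component is the sum of all $\mathcal{S}_3$-invariant subspaces of $\mathbb{P}^\perp_{n,n-1}(\widehat T)$ on which $\mathcal{S}_3$ acts by its two-dimensional irreducible (reflection)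 representation; equivalently it is $\{p\in\mathbb{P}^\perp_{n,n-1}(\widehat T): RMp+MRp=-p\}$. *)

(* Defs.v *)
From HB Require Import structures.
From mathcomp Require Import all_boot all_order all_algebra.
From mathcomp Require Import all_classical all_reals all_analysis.
Set Implicit Arguments. Unset Strict Implicit. Unset Printing Implicit Defensive.
Import Order.TTheory GRing.Theory Num.Theory.
Local Open Scope ring_scope.
Local Open Scope classical_set_scope.

Section Defs.
Variable R : realType.

(* Jacobi polynomial P_m^{(a,b)} via the explicit formula (DLMF 18.5.8):
   P_m^{(a,b)}(x) = sum_{s=0}^m C(m+a, m-s) C(m+b, s) ((x-1)/2)^s ((x+1)/2)^(m-s).
   Normalisation: P_m^{(a,b)}(1) = C(m+a,m) = (a+1)_m/m!. *)
Definition jacobi (a b m : nat) : {poly R} :=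
  \sum_(s < m.+1)
    (('C(m + a, m - s) * 'C(m + b, s))%:R : R) *:
      ((2^-1 *: ('X - 1)) ^+ s * (2^-1 *: ('X + 1)) ^+ (m - s)).

Definition legendre (k : nat) : {poly R} := jacobi 0 0 k.

(* Polynomial meaning of (x1+x2)^k p((x1-x2)/(x1+x2)) for deg p <= k. *)
Definition homog (k : nat) (p : {poly R}) (x1 x2 : R) : R :=
  \sum_(i < k.+1) p`_i * (x1 - x2) ^+ i * (x1 + x2) ^+ (k - i).

Definition bnk (n k : nat) (x1 x2 : R) : R :=
  (jacobi 0 (2 * k + 1) (n - k)).[2 * (x1 + x2) - 1] * homog k (legendre k) x1 x2.

Definition Pdeg (n : nat) (f : R -> R -> R) : Prop :=
  exists c : nat -> nat -> R, forall x1 x2,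
    f x1 x2 = \sum_(i < n.+1) \sum_(j < n.+1 | (i + j <= n)%N)
                 c i j * x1 ^+ i * x2 ^+ j.

Definition triangle : set (R * R) :=
  [set z | 0 <= z.1 /\ 0 <= z.2 /\ z.1 + z.2 <= 1].

Definition l2T (f g : R -> R -> R) : \bar R :=
  (\int[(@lebesgue_measure R \x @lebesgue_measure R)%E]_(z in triangle)
      (f z.1 z.2 * g z.1 z.2)%:E)%E.

Definition Pperp (n : nat) (f : R -> R -> R) : Prop :=
  Pdeg n f /\
  forall q, (0 < n)%N -> Pdeg n.-1 q -> l2T f q = 0%E.

Definition Mop (p : R -> R -> R) : R -> R -> R := fun x1 x2 => p (1 - x1 - x2) x2.
Definition Rop (p : R -> R -> R) : R -> R -> R := fun x1 x2 => p x2 x1.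
Definition RMop (p : R -> R -> R) := Rop (Mop p).
Definition MRop (p : R -> R -> R) := Mop (Rop p).
Definition Piop (p : R -> R -> R) : R -> R -> R :=
  fun x1 x2 => 3^-1 * (2 * p x1 x2 - MRop p x1 x2 - RMop p x1 x2).

Definition tau_refl (n : nat) (p : R -> R -> R) : Prop :=
  Pperp n p /\ forall x1 x2, RMop p x1 x2 + MRop p x1 x2 = - p x1 x2.

End Defs.

(* Main.v *)
(* Let z = 1 - x - y be the third barycentric coordinate, so that RM and MR act
   as the rotations of (x, y, z) and R swaps x and y.

   An element of P^perp_{n,n-1} is determined by its homogeneous part of degree
   n, on which the symmetries act through x + y + z = 0.  The degree n part of
   b_{n,2k} is a multiple of (x + y)^n P_{2k}((x - y)/(x + y)).  If a combination
   of the b_{n,2k} with 3k < n is killed by Pi, its degree n part is fully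
   symmetric and divisible by z^m for some m > n/3; by symmetry it is divisible
   by (xyz)^m, whose degree exceeds n, so it vanishes.  This is (a).

   For the spanning part, let h be the degree n part of an R-symmetric element
   of the reflection component, and N the number of admissible k, so 3N >= n.
   If x^N divides h, then so does y^N, and z^N divides h because the rotates of
   h sum to zero.  Thus h is a multiple of (xyz)^N, hence fully symmetric, hence
   zero.  So the R-symmetric part has dimension at most N, with coordinates the
   coefficients of h of degree below N in x, and (a) makes the N elements Pi b_{n,2k} a basis of it.  An
   R-antisymmetric element p is recovered from the R-symmetric element
   (RM - MR) p by applying -(RM - MR)/3. *)
Require Import Defs.
From HB Require Import structures.
From mathcomp Require Import all_boot all_order all_algebra.
From mathcomp Require Import all_classical all_reals all_analysis.
From mathcomp Require Import measurable_realfun ring lra zify.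
Import Order.TTheory GRing.Theory Num.Theory.
Local Open Scope ring_scope.

(** * Polynomial functions of two variables and their leading forms *)

Section PolynomialFunctions.
Set Implicit Arguments. Unset Strict Implicit.
Variable R : realType.
Implicit Types (f g H G : R -> R -> R) (p q h : {poly R}).

Lemma poly_ext p q : (forall x, p.[x] = q.[x]) -> p = q.
Proof.
move=> pq; apply/eqP; rewrite -subr_eq0; apply/eqP.
apply: (roots_geq_poly_eq0 (rs := [seq i%:R | i <- iota 0 (size (p - q))])).
- by apply/allP => x _; rewrite /root hornerD hornerN pq subrr.
- by rewrite map_inj_uniq ?iota_uniq// => i j /eqP; rewrite eqr_nat => /eqP.
- by rewrite size_map size_iota.
Qed.

Lemma coef_mul_top p q i j : (size p <= i.+1)%N -> (size q <= j.+1)%N ->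
  (p * q)`_(i + j) = p`_i * q`_j.
Proof.
move=> sp sq; have lti : (i < (i + j).+1)%N by lia.
rewrite coefM (bigD1 (Ordinal lti))//= addKn big1 ?addr0// => -[k klt]/=.
rewrite -val_eqE/= => ki; have [ik|ik] := ltnP i k.
  by rewrite (nth_default 0 (leq_trans sp ik)) mul0r.
by rewrite (@nth_default _ 0 q) ?mulr0// (leq_trans sq)//; lia.
Qed.

Lemma size_mul_top p q i j : (size p <= i.+1)%N -> (size q <= j.+1)%N ->
  (size (p * q)%R <= (i + j).+1)%N.
Proof.
move=> sp sq; rewrite (leq_trans (size_polyMleq _ _))//.
by rewrite -subn1 leq_subLR (leq_trans (leq_add sp sq))//; lia.
Qed.

Lemma Pdeg_monomial n c i j : (i + j <= n)%N ->
  Pdeg n (fun x1 x2 : R => c * x1 ^+ i * x2 ^+ j).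
Proof.
move=> ijn; exists (fun k l => if (k == i) && (l == j) then c else 0) => x1 x2.
have lti : (i < n.+1)%N by lia.
have ltj : (j < n.+1)%N by lia.
rewrite (bigD1 (Ordinal lti))//= [X in _ + X]big1 ?addr0 => [|k /negPf ki].
  rewrite (bigD1 (Ordinal ltj))//= !eqxx/= big1 ?addr0// => l /andP[_ /negPf lj].
  by rewrite -val_eqE/= in lj; rewrite lj !mul0r.
by rewrite big1// => l _; rewrite -val_eqE/= in ki; rewrite ki !mul0r.
Qed.

Lemma PdegD {n} [f g] : Pdeg n f -> Pdeg n g ->
  Pdeg n (fun x1 x2 => f x1 x2 + g x1 x2).
Proof.
move=> [c fE] [d gE]; exists (fun i j => c i j + d i j) => x1 x2.
rewrite fE gE -big_split/=; apply: eq_bigr => i _; rewrite -big_split/=.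
by apply: eq_bigr => j _; rewrite -mulrDl -mulrDl.
Qed.

Lemma PdegZ {n} a [f] : Pdeg n f -> Pdeg n (fun x1 x2 => a * f x1 x2).
Proof.
move=> [c fE]; exists (fun i j => a * c i j) => x1 x2.
rewrite fE mulr_sumr; apply: eq_bigr => i _; rewrite mulr_sumr.
by apply: eq_bigr => j _; rewrite !mulrA.
Qed.

Lemma Pdeg_ext n f g : f =2 g -> Pdeg n f -> Pdeg n g.
Proof. by move=> fg [c fE]; exists c => x1 x2; rewrite -fg. Qed.

Lemma Pdeg0 n : Pdeg n (fun _ _ : R => 0).
Proof.
by apply: Pdeg_ext (Pdeg_monomial 0 (leq0n n : (0 + 0 <= n)%N)) => x y;
  rewrite !mul0r.
Qed.

Lemma Pdeg_sum n (I : Type) (r : seq I) (P : pred I) (F : I -> R -> R -> R) :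
  (forall i, P i -> Pdeg n (F i)) ->
  Pdeg n (fun x1 x2 => \sum_(i <- r | P i) F i x1 x2).
Proof.
move=> nF; elim: r => [|i r IH].
  by apply: Pdeg_ext (Pdeg0 n) => x y; rewrite big_nil.
case Pi: (P i); last by apply: Pdeg_ext IH => x y; rewrite big_cons Pi.
by apply: Pdeg_ext (PdegD (nF i Pi) IH) => x y; rewrite big_cons Pi.
Qed.

(** The additive case keeps the degree bounds of both summands, because additivity of the integral
    over the triangle is proved for functions of bounded degree. *)
Lemma Pdeg_ind (P : (R -> R -> R) -> Prop) n :
  (forall f g, f =2 g -> P f -> P g) -> P (fun _ _ => 0) ->
  (forall f g, Pdeg n f -> Pdeg n g -> P f -> P g ->
     P (fun x1 x2 => f x1 x2 + g x1 x2)) ->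
  (forall c i j, (i + j <= n)%N -> P (fun x1 x2 => c * x1 ^+ i * x2 ^+ j)) ->
  forall f, Pdeg n f -> P f.
Proof.
move=> Pext P0 PD Pm f [c fE].
apply: (Pext (fun x1 x2 => \sum_(i < n.+1) \sum_(j < n.+1 | (i + j <= n)%N)
                 c i j * x1 ^+ i * x2 ^+ j)); first by move=> x y; rewrite fE.
(* [Q] carries the degree bound along, so that partial sums meet the hypotheses of the additive
   case. *)
pose Q f := Pdeg n f /\ P f.
have Qsum (I : Type) (r : seq I) (B : pred I) (F : I -> R -> R -> R) :
    (forall i, B i -> Q (F i)) ->
    Q (fun x1 x2 => \sum_(i <- r | B i) F i x1 x2).
  move=> nF; elim: r => [|i r [IH1 IH2]].
    by split; [apply: Pdeg_ext (Pdeg0 n)|apply: Pext P0] => x y; rewrite big_nil.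
  case Bi: (B i); last first.
    by split; [apply: Pdeg_ext IH1|apply: Pext IH2] => x y; rewrite big_cons Bi.
  have [F1 F2] := nF i Bi; split.
    by apply: Pdeg_ext (PdegD F1 IH1) => x y; rewrite big_cons Bi.
  by apply: Pext (PD _ _ F1 IH1 F2 IH2) => x y; rewrite big_cons Bi.
suff [] : Q (fun x1 x2 => \sum_(i < n.+1) \sum_(j < n.+1 | (i + j <= n)%N)
                 c i j * x1 ^+ i * x2 ^+ j) by [].
apply: (Qsum) => i _; apply: (Qsum) => j ij.
by split; [exact: Pdeg_monomial|exact: Pm].
Qed.

Lemma Pdeg_leq m n f : (m <= n)%N -> Pdeg m f -> Pdeg n f.
Proof.
move=> mn; apply: Pdeg_ind; [exact: Pdeg_ext|exact: Pdeg0|by move=> ? ? _ _; apply: PdegD|].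
by move=> c i j ij; apply: Pdeg_monomial; lia.
Qed.

Lemma PdegM m n f g : Pdeg m f -> Pdeg n g ->
  Pdeg (m + n) (fun x1 x2 => f x1 x2 * g x1 x2).
Proof.
move=> mf ng; move: f mf; apply: Pdeg_ind.
- by move=> f f' ff'; apply: Pdeg_ext => x y; rewrite ff'.
- by apply: Pdeg_ext (Pdeg0 _) => x y; rewrite mul0r.
- by move=> f f' _ _ Pf Pf'; apply: Pdeg_ext (PdegD Pf Pf') => x y; rewrite mulrDl.
move=> c i j ij; move: g ng; apply: Pdeg_ind.
- by move=> f f' ff'; apply: Pdeg_ext => x y; rewrite ff'.
- by apply: Pdeg_ext (Pdeg0 _) => x y; rewrite mulr0.
- by move=> f f' _ _ Pf Pf'; apply: Pdeg_ext (PdegD Pf Pf') => x y; rewrite mulrDr.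
move=> d k l kl; have ijkl : ((i + k) + (j + l) <= m + n)%N by lia.
by apply: Pdeg_ext (Pdeg_monomial (c * d) ijkl) => x y; rewrite !exprD; ring.
Qed.

Lemma PdegC n a : Pdeg n (fun _ _ : R => a).
Proof.
by apply: Pdeg_ext (Pdeg_monomial a (leq0n n : (0 + 0 <= n)%N)) => x y;
  rewrite !mulr1.
Qed.

Lemma Pdeg_x1 : Pdeg 1 (fun x1 _ : R => x1).
Proof.
by apply: Pdeg_ext (Pdeg_monomial 1 (isT : (1 + 0 <= 1)%N)) => x y; ring.
Qed.

Lemma Pdeg_x2 : Pdeg 1 (fun _ x2 : R => x2).
Proof.
by apply: Pdeg_ext (Pdeg_monomial 1 (isT : (0 + 1 <= 1)%N)) => x y; ring.
Qed.

Lemma PdegX k n f : Pdeg n f -> Pdeg (k * n) (fun x1 x2 => f x1 x2 ^+ k).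
Proof.
move=> nf; elim: k => [|k IH]; first by apply: Pdeg_ext (PdegC _ 1).
by rewrite mulSn; apply: Pdeg_ext (PdegM nf IH) => x y; rewrite exprS.
Qed.

Lemma Pdeg_comp n f u v : Pdeg 1 u -> Pdeg 1 v -> Pdeg n f ->
  Pdeg n (fun x1 x2 => f (u x1 x2) (v x1 x2)).
Proof.
move=> u1 v1; move: f; apply: Pdeg_ind.
- by move=> f g fg; apply: Pdeg_ext => x y; rewrite fg.
- exact: Pdeg0.
- by move=> f g _ _; exact: PdegD.
move=> c i j ij.
have := PdegM (PdegZ c (PdegX i u1)) (PdegX j v1); rewrite !muln1.
exact: Pdeg_leq.
Qed.

Lemma Pdeg_RM n f : Pdeg n f -> Pdeg n (RMop f).
Proof.
apply: (Pdeg_comp (u := fun x1 x2 => 1 - x2 - x1)); last exact: Pdeg_x1.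
have D := PdegD (PdegD (PdegC 1 1) (PdegZ (-1) Pdeg_x2)) (PdegZ (-1) Pdeg_x1).
by apply: Pdeg_ext D => x y; ring.
Qed.

Lemma Pdeg_MR n f : Pdeg n f -> Pdeg n (MRop f).
Proof.
apply: (Pdeg_comp (v := fun x1 x2 => 1 - x1 - x2)); first exact: Pdeg_x2.
have D := PdegD (PdegD (PdegC 1 1) (PdegZ (-1) Pdeg_x1)) (PdegZ (-1) Pdeg_x2).
by apply: Pdeg_ext D => x y; ring.
Qed.

Lemma Pdeg_R n f : Pdeg n f -> Pdeg n (Rop f).
Proof. exact: Pdeg_comp Pdeg_x2 Pdeg_x1. Qed.

Lemma Pdeg_horner n f (u v : {poly R}) : Pdeg n f ->
  exists w : {poly R}, forall t, w.[t] = f u.[t] v.[t].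
Proof.
move: f; apply: Pdeg_ind.
- by move=> f g fg [w wE]; exists w => t; rewrite wE fg.
- by exists 0 => t; rewrite horner0.
- by move=> f g _ _ [w wE] [w' wE']; exists (w + w') => t; rewrite hornerD wE wE'.
by move=> c i j _; exists (c *: u ^+ i * v ^+ j) => t; rewrite !hornerE.
Qed.

(* [H] is the degree-[n] homogeneous part of [f]; reading it off along every
   affine line makes it equivariant under affine substitutions. *)
Definition leading_form n f H := forall a1 x1 a2 x2, exists q : {poly R},
  [/\ (size q <= n.+1)%N, q`_n = H x1 x2 &
      forall t, f (a1 + t * x1) (a2 + t * x2) = q.[t]].

Lemma leading_form_ext n f g H G : f =2 g -> H =2 G ->
  leading_form n f H -> leading_form n g G.
Proof.
move=> fg HG fH a1 x1 a2 x2; have [q [sq qn qE]] := fH a1 x1 a2 x2.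
by exists q; split; rewrite -?HG// => t; rewrite -fg.
Qed.

(** Lines through the origin suffice: the polynomial along such a line is determined by its values,
    hence so is its coefficient of degree [n]. *)
Lemma leading_form_uniq [n f H G] :
  leading_form n f H -> leading_form n f G -> H =2 G.
Proof.
move=> fH fG x y; have [q [_ <- qE]] := fH 0 x 0 y.
have [r [_ <- rE]] := fG 0 x 0 y.
by suff -> : q = r by []; apply: poly_ext => t; rewrite -qE rE.
Qed.

Lemma leading_form0 n : leading_form n (fun _ _ => 0) (fun _ _ => 0).
Proof.
by move=> *; exists 0; split; rewrite ?size_poly0 ?coef0// => t; rewrite horner0.
Qed.

Lemma leading_formD [n f g H G] : leading_form n f H -> leading_form n g G ->
  leading_form n (fun x1 x2 => f x1 x2 + g x1 x2) (fun x1 x2 => H x1 x2 + G x1 x2).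
Proof.
move=> fH gG a1 x1 a2 x2; have [q [sq qn qE]] := fH a1 x1 a2 x2.
have [r [sr rn rE]] := gG a1 x1 a2 x2; exists (q + r); split.
- by rewrite (leq_trans (size_polyD _ _))// geq_max sq sr.
- by rewrite coefD qn rn.
- by move=> t; rewrite qE rE hornerD.
Qed.

Lemma leading_formZ [n f H] a : leading_form n f H ->
  leading_form n (fun x1 x2 => a * f x1 x2) (fun x1 x2 => a * H x1 x2).
Proof.
move=> fH a1 x1 a2 x2; have [q [sq qn qE]] := fH a1 x1 a2 x2.
exists (a *: q); split; first by rewrite (leq_trans (size_scale_leq _ _)).
- by rewrite coefZ qn.
- by move=> t; rewrite qE hornerZ.
Qed.

Lemma leading_form_sum n (I : Type) (r : seq I) (P : pred I)
    (F H : I -> R -> R -> R) : (forall i, P i -> leading_form n (F i) (H i)) ->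
  leading_form n (fun x1 x2 => \sum_(i <- r | P i) F i x1 x2)
                 (fun x1 x2 => \sum_(i <- r | P i) H i x1 x2).
Proof.
move=> FH; elim: r => [|i r IH].
  by apply: leading_form_ext (leading_form0 n) => x y; rewrite big_nil.
case Pi: (P i); last by apply: leading_form_ext IH => x y; rewrite big_cons Pi.
by apply: leading_form_ext (leading_formD (FH i Pi) IH) => x y;
  rewrite big_cons Pi.
Qed.

Lemma leading_formM [m n f g H G] : leading_form m f H -> leading_form n g G ->
  leading_form (m + n) (fun x1 x2 => f x1 x2 * g x1 x2)
                       (fun x1 x2 => H x1 x2 * G x1 x2).
Proof.
move=> fH gG a1 x1 a2 x2; have [q [sq qn qE]] := fH a1 x1 a2 x2.
have [r [sr rn rE]] := gG a1 x1 a2 x2; exists (q * r); split.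
- exact: size_mul_top.
- by rewrite coef_mul_top// qn rn.
- by move=> t; rewrite qE rE hornerM.
Qed.

Lemma leading_formX k [n f H] : leading_form n f H ->
  leading_form (k * n) (fun x1 x2 => f x1 x2 ^+ k) (fun x1 x2 => H x1 x2 ^+ k).
Proof.
move=> fH; elim: k => [|k IH].
  move=> *; exists 1; split; rewrite ?size_poly1 ?coef1// => t.
  by rewrite hornerC expr0.
by rewrite mulSn; apply: leading_form_ext (leading_formM fH IH) => x y; rewrite exprS.
Qed.

Lemma leading_form_x1 : leading_form 1 (fun x1 _ => x1) (fun x1 _ => x1).
Proof.
move=> a1 x1 a2 x2; exists (a1%:P + x1 *: 'X); split.
- rewrite (leq_trans (size_polyD _ _))// geq_max.
  by rewrite (leq_trans (size_polyC_leq1 _))// (leq_trans (size_scale_leq _ _)) ?size_polyX.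
- by rewrite coefD coefC coefZ coefX/= add0r mulr1.
- by move=> t; rewrite !hornerE mulrC.
Qed.

(** [U] and [V] are the linear parts of the affine maps [u] and [v]. Such maps move the base point
    of a line as well as its direction, which is why [leading_form] quantifies over both. *)
Lemma leading_form_comp [n f H u v U V] :
  (forall a1 x1 a2 x2 t, u (a1 + t * x1) (a2 + t * x2) = u a1 a2 + t * U x1 x2) ->
  (forall a1 x1 a2 x2 t, v (a1 + t * x1) (a2 + t * x2) = v a1 a2 + t * V x1 x2) ->
  leading_form n f H ->
  leading_form n (fun x1 x2 => f (u x1 x2) (v x1 x2))
                 (fun x1 x2 => H (U x1 x2) (V x1 x2)).
Proof.
move=> uU vV fH a1 x1 a2 x2.
have [q [sq qn qE]] := fH (u a1 a2) (U x1 x2) (v a1 a2) (V x1 x2).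
by exists q; split => // t; rewrite uU vV.
Qed.

Lemma leading_form_R n f H : leading_form n f H ->
  leading_form n (Rop f) (fun x1 x2 => H x2 x1).
Proof. exact: leading_form_comp. Qed.

Lemma leading_form_RM n f H : leading_form n f H ->
  leading_form n (RMop f) (fun x1 x2 => H (- x1 - x2) x1).
Proof.
apply: (leading_form_comp (u := fun x1 x2 => 1 - x2 - x1)
  (U := fun x1 x2 => - x1 - x2)) => //.
by move=> *; ring.
Qed.

Lemma leading_form_MR n f H : leading_form n f H ->
  leading_form n (MRop f) (fun x1 x2 => H x2 (- x1 - x2)).
Proof.
apply: (leading_form_comp (v := fun x1 x2 => 1 - x1 - x2)
  (V := fun x1 x2 => - x1 - x2)) => //.
by move=> *; ring.
Qed.

Lemma leading_form_x2 : leading_form 1 (fun _ x2 => x2) (fun _ x2 => x2).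
Proof. exact: leading_form_R leading_form_x1. Qed.

Lemma leading_form_lt [m n f H] : (m < n)%N -> leading_form m f H ->
  leading_form n f (fun _ _ => 0).
Proof.
move=> mn fH a1 x1 a2 x2; have [q [sq _ qE]] := fH a1 x1 a2 x2.
exists q; split => //; first by rewrite (leq_trans sq)// ltnW.
by rewrite nth_default// (leq_trans sq).
Qed.

Lemma leading_form_monomial c i j :
  leading_form (i + j) (fun x1 x2 => c * x1 ^+ i * x2 ^+ j)
                       (fun x1 x2 => c * x1 ^+ i * x2 ^+ j).
Proof.
have := leading_formM (leading_formX i leading_form_x1) (leading_formX j leading_form_x2).
rewrite !muln1 => /(leading_formZ c).
by apply: leading_form_ext => x y; rewrite mulrA.
Qed.

(* The binary form of degree [n] with dehomogenization [h] at [x2 = 1]. *)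
Definition binary_form n h (x1 x2 : R) := \sum_(i < n.+1) h`_i * x1 ^+ i * x2 ^+ (n - i).

Lemma binary_form1 n h x : (size h <= n.+1)%N -> binary_form n h x 1 = h.[x].
Proof.
move=> sh; rewrite (horner_coef_wide _ sh).
by apply: eq_bigr => i _; rewrite expr1n mulr1.
Qed.

Lemma binary_form0 n x y : binary_form n 0 x y = 0.
Proof. by rewrite /binary_form big1// => i _; rewrite coef0 !mul0r. Qed.

Lemma binary_form_inj n h (k : {poly R}) : (size h <= n.+1)%N -> (size k <= n.+1)%N ->
  (forall x, binary_form n h x 1 = binary_form n k x 1) -> h = k.
Proof. by move=> sh sk hk; apply: poly_ext => x; have := hk x; rewrite !binary_form1. Qed.

(** For [n = 0] the bound [n.-1] is again 0 and would allow a constant remainder, hence the separate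
    last clause. *)
Lemma Pdeg_leading_form_split n f : Pdeg n f -> exists (h : {poly R}) g,
  [/\ (size h <= n.+1)%N, leading_form n f (binary_form n h),
      (forall x y, f x y = binary_form n h x y + g x y),
      (0 < n)%N -> Pdeg n.-1 g & n = 0%N -> forall x y, g x y = 0].
Proof.
move: f; apply: Pdeg_ind.
- move=> f f' ff' [h [g [sh lh fE gn g0]]]; exists h, g; split => //.
    by apply: leading_form_ext lh.
  by move=> x y; rewrite -ff'.
- exists 0, (fun _ _ => 0); split; rewrite ?size_poly0//.
  + by apply: leading_form_ext (leading_form0 n) => x y; rewrite ?binary_form0.
  + by move=> x y; rewrite binary_form0 addr0.
  + by move=> _; exact: Pdeg0.
- move=> f f' _ _ [h [g [sh lh fE gn g0]]] [h' [g' [sh' lh' fE' gn' g0']]].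
  have hh' x y : binary_form n (h + h') x y = binary_form n h x y + binary_form n h' x y.
    by rewrite /binary_form -big_split; apply: eq_bigr => i _; rewrite coefD !mulrDl.
  exists (h + h'), (fun x y => g x y + g' x y); split.
  + by rewrite (leq_trans (size_polyD _ _))// geq_max sh.
  + by apply: leading_form_ext (leading_formD lh lh') => x y.
  + by move=> x y; rewrite hh' fE fE'; ring.
  + by move=> n0; exact: PdegD (gn n0) (gn' n0).
  + by move=> n0 x y; rewrite g0// g0'// addr0.
move=> c i j; rewrite leq_eqVlt => /predU1P[<-|ijn]; last first.
  exists 0, (fun x y => c * x ^+ i * y ^+ j); split; rewrite ?size_poly0//.
  + by apply: leading_form_ext (leading_form_lt ijn (leading_form_monomial c i j))
      => x y; rewrite ?binary_form0.
  + by move=> x y; rewrite binary_form0 add0r.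
  + by move=> _; apply: Pdeg_monomial; lia.
  + by move=> n0; rewrite n0 in ijn.
have ilt : (i < (i + j).+1)%N by lia.
have fE x y : binary_form (i + j) (c *: 'X^i) x y = c * x ^+ i * y ^+ j.
  rewrite /binary_form (bigD1 (Ordinal ilt))//= coefZ coefXn eqxx mulr1 addKn.
  rewrite big1 ?addr0// => k; rewrite -val_eqE/= => /negPf ki.
  by rewrite coefZ coefXn ki mulr0 !mul0r.
exists (c *: 'X^i), (fun _ _ => 0); split => //.
+ by rewrite (leq_trans (size_scale_leq _ _))// size_polyXn.
+ by apply: leading_form_ext (leading_form_monomial c i j) => x y.
+ by move=> x y; rewrite fE addr0.
+ by move=> _; exact: Pdeg0.
Qed.

Lemma Pdeg_leading_form [n f] : Pdeg n f ->
  exists2 h : {poly R}, (size h <= n.+1)%N & leading_form n f (binary_form n h).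
Proof. by case/Pdeg_leading_form_split => h [g [sh lh _ _ _]]; exists h. Qed.

Lemma leading_form_eq0 n f : Pdeg n f -> leading_form n f (fun _ _ => 0) ->
  ((0 < n)%N /\ Pdeg n.-1 f) \/ forall x y, f x y = 0.
Proof.
move=> /Pdeg_leading_form_split[h [g [sh lh fE gn g0]]] l0.
have h0 := leading_form_uniq lh l0.
case: n => [|n] in sh lh fE gn g0 l0 h0 *.
  by right => x y; rewrite fE h0 g0// addr0.
by left; split => //; apply: Pdeg_ext (gn isT) => x y; rewrite fE h0 add0r.
Qed.

(** Along a line through the origin [f] is a constant times [t ^+ d], so the polynomial read off
    there is a monomial. *)
Lemma leading_form_homogeneous d f : Pdeg d f ->
  (forall t x y, f (t * x) (t * y) = t ^+ d * f x y) -> leading_form d f f.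
Proof.
move=> df hf; have [h sh lh] := Pdeg_leading_form df.
apply: leading_form_ext (lh) => // x y.
have [q [_ <- qE]] := lh 0 x 0 y.
suff -> : q = f x y *: 'X^d by rewrite coefZ coefXn eqxx mulr1.
by apply: poly_ext => t; rewrite -qE !add0r hf !hornerE mulrC.
Qed.

Lemma homogeneous_form d f : Pdeg d f ->
  (forall t x y, f (t * x) (t * y) = t ^+ d * f x y) ->
  exists2 h : {poly R}, (size h <= d.+1)%N & f =2 binary_form d h.
Proof.
move=> df hf; have [h sh lh] := Pdeg_leading_form df; exists h => //.
exact: leading_form_uniq (leading_form_homogeneous df hf) lh.
Qed.

End PolynomialFunctions.

(** * Integration of one-variable polynomials over the unit interval *)

Section IntegralUnitInterval.
Variable R : realType.
Import numFieldNormedType.Exports.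
Set Implicit Arguments. Unset Strict Implicit.
Implicit Types p q : {poly R}.

(** The integral over [0, 1], given by coefficients so that orthogonality becomes finite algebra;
    [integral_horner01] identifies it with the Lebesgue integral. *)
Definition int01 p : R := \sum_(i < size p) p`_i / i.+1%:R.

Lemma int01_wide n p : (size p <= n)%N -> int01 p = \sum_(i < n) p`_i / i.+1%:R.
Proof.
move=> sp; rewrite /int01 (big_ord_widen n (fun i => p`_i / i.+1%:R) sp).
rewrite big_mkcond; apply: eq_bigr => i _; case: ltnP => // pi.
by rewrite nth_default// mul0r.
Qed.

Lemma int01D p q : int01 (p + q) = int01 p + int01 q.
Proof.
rewrite !(@int01_wide (maxn (size p) (size q))) ?leq_maxl ?leq_maxr ?size_polyD//.
by rewrite -big_split/=; apply: eq_bigr => i _; rewrite coefD mulrDl.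
Qed.

Lemma int01Z a p : int01 (a *: p) = a * int01 p.
Proof.
rewrite (@int01_wide (size p)) ?size_scale_leq// mulr_sumr.
by apply: eq_bigr => i _; rewrite coefZ mulrA.
Qed.

Lemma int01B p q : int01 (p - q) = int01 p - int01 q.
Proof. by rewrite int01D -scaleN1r int01Z mulN1r. Qed.

Lemma int01_sum (I : Type) (r : seq I) (P : pred I) (F : I -> {poly R}) :
  int01 (\sum_(i <- r | P i) F i) = \sum_(i <- r | P i) int01 (F i).
Proof.
by apply: (big_morph int01 int01D); rewrite /int01 size_poly0 big_ord0.
Qed.

Lemma int01_Xn k : int01 'X^k = k.+1%:R^-1.
Proof.
rewrite /int01 size_polyXn big_ord_recr/= coefXn eqxx mul1r big1 ?add0r// => i _.
by rewrite coefXn (ltn_eqF (ltn_ord i)) mul0r.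
Qed.

Lemma factr_neq0 k : k`!%:R != 0 :> R.
Proof. by rewrite pnatr_eq0 -lt0n fact_gt0. Qed.

Lemma factSr k : k.+1`!%:R = (1 + k%:R) * k`!%:R :> R.
Proof. by rewrite factS natrM nat1r. Qed.

(** Euler's beta integral, by induction on [j]: splitting off one factor 1 - X leaves a difference
    of two known values. *)
Lemma int01_beta i j :
  int01 ('X^i * (1 - 'X) ^+ j) = (i`! * j`!)%:R / (i + j).+1`!%:R.
Proof.
have Sn0 k : 1 + k%:R != 0 :> R by rewrite nat1r pnatr_eq0.
elim: j i => [|j IH] i.
  rewrite mulr1 int01_Xn addn0 fact0 muln1 factS natrM -nat1r.
  by field; rewrite factr_neq0 Sn0.
rewrite exprSr mulrA mulrBr mulr1 int01B IH -mulrA [_ * 'X]mulrC mulrA -exprSr IH.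
rewrite addSn addnS (natrM _ i`! j`!) (natrM _ i.+1`! j`!) (natrM _ i`! j.+1`!).
rewrite !(factSr (i + j).+1) (factSr i) (factSr j).
rewrite -[(i + j).+1%:R]natr1 natrD; field.
by rewrite factr_neq0/=; have := Sn0 (i + j).+1; rewrite -natr1 natrD.
Qed.

Local Notation mu := (@lebesgue_measure R).

Lemma integral_deriv_horner p (a b : R) : a <= b ->
  (\int[mu]_(x in `[a, b]%classic) (p^`().[x])%:E = (p.[b] - p.[a])%:E)%E.
Proof.
rewrite le_eqVlt => /predU1P[->|ab].
  by rewrite set_itv1 integral_set1 subrr.
rewrite (@continuous_FTC2 _ _ (horner p)) ?EFinB//.
- exact/continuous_subspaceT/continuous_horner.
- split.
  + by move=> x _; exact: derivable_horner.
  + by apply: cvg_at_right_filter; exact: continuous_horner.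
  + by apply: cvg_at_left_filter; exact: continuous_horner.
- by move=> x _; rewrite derivE.
Qed.

Lemma integral_exprM k (c a : R) : 0 <= a ->
  (\int[mu]_(x in `[0%R, a]%classic) (x ^+ k * c)%:E
    = (a ^+ k.+1 / k.+1%:R * c)%:E)%E.
Proof.
move=> a0; pose P : {poly R} := (c / k.+1%:R) *: 'X^(k.+1).
have kn0 : k.+1%:R != 0 :> R by rewrite pnatr_eq0.
transitivity (\int[mu]_(x in `[0%R, a]%classic) (P^`().[x])%:E)%E.
  apply: eq_integral => x _; congr EFin; rewrite derivZ derivXn hornerZ hornerMn.
  by rewrite hornerXn -pred_Sn -(mulr_natr (x ^+ k)); field.
rewrite integral_deriv_horner// !hornerE expr0n/=; congr EFin; field.
by rewrite nat1r.
Qed.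

Lemma integral_horner01 p :
  (\int[mu]_(x in `[0%R, 1%R]%classic) (p.[x])%:E = (int01 p)%:E)%E.
Proof.
pose P := \poly_(k < (size p).+1) (p`_k.-1 / k%:R).
have dP : P^`() = p.
  apply/polyP => i; rewrite coef_deriv coef_poly ltnS; case: ltnP => [_|pi]/=.
    by rewrite -(mulr_natr (_ / _)) divfK ?pnatr_eq0.
  by rewrite mul0rn nth_default.
rewrite -[in LHS]dP integral_deriv_horner// horner_coef0 coef_poly/= invr0 mulr0.
rewrite subr0 (horner_coef_wide _ (size_poly _ _)) big_ord_recl coef_poly/=.
rewrite invr0 mulr0 mul0r add0r; congr EFin; apply: eq_bigr => i _.
by rewrite coef_poly ltnS ltn_ord expr1n mulr1.
Qed.

End IntegralUnitInterval.

(** * Lebesgue integration of polynomial functions over the triangle *)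

Section IntegralTriangle.
Variable R : realType.
Import numFieldNormedType.Exports.
Set Implicit Arguments. Unset Strict Implicit.
Implicit Types f g : R -> R -> R.

Local Notation mu := (@lebesgue_measure R).
Local Notation mu2 := (mu \x mu)%E.
Local Notation M := (measurableTypeR R).
Local Notation T := (@triangle R : set (M * M)).

Lemma measurable_triangle : measurable T.
Proof.
have -> : T = ([set z : M * M | 0 <= z.1] `&` ([set z : M * M | 0 <= z.2] `&`
    [set z : M * M | z.1 + z.2 <= 1]))%classic by [].
apply: measurableI; [|apply: measurableI].
- rewrite -[X in measurable X]setTI.
  rewrite (_ : [set z : M * M | _] = fst @^-1` `[0%R, +oo[)%classic.
    exact: measurable_fst.
  by apply/seteqP; split => z /=; rewrite in_itv/= andbT.
- rewrite -[X in measurable X]setTI.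
  rewrite (_ : [set z : M * M | _] = snd @^-1` `[0%R, +oo[)%classic.
    exact: measurable_snd.
  by apply/seteqP; split => z /=; rewrite in_itv/= andbT.
- rewrite -[X in measurable X]setTI.
  rewrite (_ : [set z : M * M | _] =
      (fun z : M * M => z.1 + z.2) @^-1` `]-oo, 1%R])%classic.
    exact: measurable_funD.
  by apply/seteqP; split => z /=; rewrite in_itv.
Qed.

Lemma Pdeg_measurable n f : Pdeg n f ->
  measurable_fun [set: M * M] (fun z => f z.1 z.2).
Proof.
move: f; apply: Pdeg_ind.
- by move=> f g fg mf; rewrite (_ : (fun z => _) = (fun z => f z.1 z.2))//;
    apply/funext => z; rewrite fg.
- exact: measurable_cst.
- by move=> f g _ _; exact: measurable_funD.
- move=> c i j _; apply: measurable_funM; first apply: measurable_funM.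
  + exact: measurable_cst.
  + by apply: measurable_funX; exact: measurable_fst.
  + by apply: measurable_funX; exact: measurable_snd.
Qed.

(** By Tonelli, integrating over 0 <= x <= 1 - y first leaves a beta integral in y. *)
Lemma integral_triangle_monomial i j :
  (\int[mu2]_(z in T) (z.1 ^+ i * z.2 ^+ j)%:E
    = ((i`! * j`!)%:R / (i + j).+2`!%:R)%:E)%E.
Proof.
rewrite integral_mkcond; set F := (X in integral _ _ X).
have FE x y : F (x, y) = if [&& 0 <= x, 0 <= y & x + y <= 1]
    then (x ^+ i * y ^+ j)%:E else 0%E.
  rewrite /F patchE; congr (if _ then _ else _).
  by apply/idP/idP; [rewrite inE => -[/= ? [? ?]]; apply/and3P|
    move=> /and3P[? ? ?]; rewrite inE].
rewrite (fubini_tonelli2 F); last 2 first.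
- apply/(measurable_restrictT _ measurable_triangle)/measurable_EFinP/measurable_funTS.
  have /Pdeg_measurable := Pdeg_monomial (1 : R) (leqnn (i + j)).
  by under eq_fun do rewrite mul1r.
- move=> [x y]; rewrite FE; case: ifP => // /and3P[x0 y0 _].
  by rewrite lee_fin mulr_ge0// exprn_ge0.
(* [Q] is the inner integral over x, as a polynomial in y. *)
pose Q : {poly R} := i.+1%:R^-1 *: ('X^j * (1 - 'X) ^+ i.+1).
transitivity (\int[mu]_y (((fun y => (Q.[y])%:E) \_ `[0%R, 1%R]) y))%E; last first.
  rewrite -integral_mkcond integral_horner01 int01Z int01_beta; congr EFin.
  rewrite addnS addnC (natrM _ j`! i.+1`!) (natrM _ i`! j`!) factSr.
  by field; rewrite factr_neq0 nat1r pnatr_eq0.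
apply: eq_integral => y _; rewrite patchE; case: ifPn; last first.
  rewrite notin_setE/= in_itv/= => y01; rewrite /fubini_G integral0_eq// => x _.
  rewrite FE; case: ifP => // /and3P[x0 y0 xy]; exfalso; apply: y01 => //.
  by rewrite y0/=; lra.
rewrite inE/= in_itv/= => /andP[y0 y1].
pose D := `[0, 1 - (y : R)]%classic.
transitivity (\int[mu]_x (((fun x => (x ^+ i * (y : R) ^+ j)%:E) \_ D) x))%E.
  apply: eq_integral => x _; rewrite FE patchE.
  suff -> : (x \in D) = [&& 0 <= x, 0 <= y & x + y <= 1] by [].
  by rewrite mem_setE in_itv/= y0/= lerBrDr.
rewrite -integral_mkcond integral_exprM ?subr_ge0//; congr EFin.
by rewrite !hornerE/=; ring.
Qed.


Lemma Pdeg_integrable n f : Pdeg n f ->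
  mu2.-integrable T (fun z => (f z.1 z.2)%:E).
Proof.
move: f; apply: Pdeg_ind.
- move=> f g fg; apply: eq_integrable => [|z _]; last by rewrite fg.
  exact: measurable_triangle.
- exact: integrable0.
- move=> f g _ _ fi gi; have := integrableD measurable_triangle fi gi.
  by apply: eq_integrable => //; exact: measurable_triangle.
move=> c i j _.
have mi : mu2.-integrable T (fun z => (z.1 ^+ i * z.2 ^+ j)%:E).
  apply/integrableP; split.
    apply/measurable_EFinP/measurable_funTS.
    have /Pdeg_measurable := Pdeg_monomial (1 : R) (leqnn (i + j)).
    by under eq_fun do rewrite mul1r.
  under eq_integral => z zT.
    rewrite gee0_abs; last first.
      move: zT; rewrite inE => -[/= z1 [z2 _]].
      by rewrite lee_fin mulr_ge0// exprn_ge0.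
    over.
  by rewrite integral_triangle_monomial ltry.
have := integrableZl measurable_triangle c mi.
apply: eq_integrable => [|z _]; first exact: measurable_triangle.
by rewrite -EFinM mulrA.
Qed.

Definition int_triangle f : R := \int[mu2]_(z in T) f z.1 z.2.

Lemma int_triangle_ext f g : f =2 g -> int_triangle f = int_triangle g.
Proof. by move=> fg; apply: eq_Rintegral => z _; rewrite fg. Qed.

Lemma int_triangle0 : int_triangle (fun _ _ => 0) = 0.
Proof. by rewrite /int_triangle /Rintegral integral0. Qed.

Lemma int_triangleD n f g : Pdeg n f -> Pdeg n g ->
  int_triangle (fun x1 x2 => f x1 x2 + g x1 x2) = int_triangle f + int_triangle g.
Proof.
move=> /Pdeg_integrable fi /Pdeg_integrable gi.
by rewrite /int_triangle RintegralD//; exact: measurable_triangle.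
Qed.

Lemma int_triangleZ n a f : Pdeg n f ->
  int_triangle (fun x1 x2 => a * f x1 x2) = a * int_triangle f.
Proof.
move=> /Pdeg_integrable fi.
by rewrite /int_triangle RintegralZl//; exact: measurable_triangle.
Qed.

Lemma int_triangle_monomial c i j :
  int_triangle (fun x1 x2 => c * x1 ^+ i * x2 ^+ j)
    = c * ((i`! * j`!)%:R / (i + j).+2`!%:R).
Proof.
rewrite (@int_triangle_ext _ (fun x1 x2 => c * (1 * x1 ^+ i * x2 ^+ j))).
  rewrite (int_triangleZ _ (Pdeg_monomial 1 (leqnn (i + j)))); congr (_ * _).
  rewrite /int_triangle /Rintegral; under eq_integral do rewrite mul1r.
  by rewrite integral_triangle_monomial.
by move=> x y; rewrite mul1r mulrA.
Qed.

Lemma l2TE m n f g : Pdeg m f -> Pdeg n g ->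
  l2T f g = (int_triangle (fun x1 x2 => f x1 x2 * g x1 x2))%:E.
Proof.
move=> mf ng; rewrite /l2T /int_triangle /Rintegral fineK//.
apply: integrable_fin_num; first exact: measurable_triangle.
exact: Pdeg_integrable (PdegM mf ng).
Qed.

(* The value is symmetric in the three barycentric coordinates, whence the
   invariance of the integral under the symmetries of the triangle. *)
Lemma int_triangle_barycentric i j k :
  int_triangle (fun x1 x2 => x1 ^+ i * x2 ^+ j * (1 - x1 - x2) ^+ k)
    = i`!%:R * j`!%:R * k`!%:R / (i + j + k).+2`!%:R.
Proof.
have lin : Pdeg 1 (fun x1 x2 : R => 1 - x1 - x2).
  have D := PdegD (PdegD (PdegC 1 1) (PdegZ (-1) (@Pdeg_x1 R))) (PdegZ (-1) (@Pdeg_x2 R)).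
  by apply: Pdeg_ext D => x y; ring.
have P l a b : Pdeg (a + b + l * 1)
    (fun x1 x2 : R => x1 ^+ a * x2 ^+ b * (1 - x1 - x2) ^+ l).
  apply: PdegM (PdegX l lin).
  by apply: Pdeg_ext (Pdeg_monomial 1 (leqnn (a + b))) => x y; rewrite mul1r.
elim: k i j => [|k IH] i j.
  rewrite (@int_triangle_ext _ (fun x1 x2 => 1 * x1 ^+ i * x2 ^+ j)).
    by rewrite int_triangle_monomial mul1r natrM mulr1 addn0.
  by move=> x y; rewrite mulr1 mul1r.
pose F a b x1 x2 : R := x1 ^+ a * x2 ^+ b * (1 - x1 - x2) ^+ k.
have PF a b : (a + b <= (i + j).+1)%N -> Pdeg ((i + j).+1 + k * 1) (F a b).
  by move=> ab; apply: Pdeg_leq (P k a b); rewrite leq_add2r.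
rewrite (@int_triangle_ext _ (fun x1 x2 => F i j x1 x2
    + (-1 * F i.+1 j x1 x2 + -1 * F i j.+1 x1 x2))); last first.
  by move=> x y; rewrite /F !exprSr; ring.
have P1 : (i.+1 + j <= (i + j).+1)%N by lia.
have P2 : (i + j.+1 <= (i + j).+1)%N by lia.
rewrite (int_triangleD (PF _ _ (leqnSn _))
  (PdegD (PdegZ _ (PF _ _ P1)) (PdegZ _ (PF _ _ P2)))).
rewrite (int_triangleD (PdegZ _ (PF _ _ P1)) (PdegZ _ (PF _ _ P2))).
rewrite (int_triangleZ _ (PF _ _ P1)) (int_triangleZ _ (PF _ _ P2)).
rewrite /F !IH addSn !addnS addSn !(factSr _ (i + j + k).+2).
rewrite (factSr _ i) (factSr _ j) (factSr _ k) -[(i + j + k).+2%:R]natr1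
  -[(i + j + k).+1%:R]natr1 (natrD _ (i + j) k) (natrD _ i j).
field; rewrite factr_neq0/=.
have : 0 <= i%:R + j%:R + k%:R :> R by rewrite !addr_ge0.
by move=> *; lra.
Qed.

(** By linearity it suffices to compare both sides on monomials, where the hypothesis supplies the
    value. *)
Lemma int_triangle_comp n u v f : Pdeg 1 u -> Pdeg 1 v ->
  (forall i j, int_triangle (fun x1 x2 => u x1 x2 ^+ i * v x1 x2 ^+ j)
     = i`!%:R * j`!%:R / (i + j).+2`!%:R) ->
  Pdeg n f ->
  int_triangle (fun x1 x2 => f (u x1 x2) (v x1 x2)) = int_triangle f.
Proof.
move=> u1 v1 uv; move: f; apply: Pdeg_ind.
- move=> f g fg fE; rewrite -(int_triangle_ext fg) -fE; apply: int_triangle_ext => x y.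
  by rewrite fg.
- by rewrite int_triangle0.
- move=> f g nf ng fE gE; rewrite (int_triangleD nf ng).
  by rewrite (int_triangleD (Pdeg_comp u1 v1 nf) (Pdeg_comp u1 v1 ng)) fE gE.
move=> c i j _; rewrite int_triangle_monomial natrM -uv.
rewrite -(int_triangleZ c (PdegM (PdegX i u1) (PdegX j v1))).
by apply: int_triangle_ext => x y; rewrite mulrA.
Qed.

Lemma int_triangle_R n f : Pdeg n f -> int_triangle (Rop f) = int_triangle f.
Proof.
apply: int_triangle_comp (@Pdeg_x2 R) (@Pdeg_x1 R) _ => i j.
rewrite (@int_triangle_ext _ (fun x1 x2 => 1 * x1 ^+ j * x2 ^+ i)).
  by rewrite int_triangle_monomial mul1r natrM [(j + i)%N]addnC [j`!%:R * _]mulrC.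
by move=> x y; rewrite mul1r mulrC.
Qed.

Lemma int_triangle_RM n f : Pdeg n f -> int_triangle (RMop f) = int_triangle f.
Proof.
apply: (int_triangle_comp (u := fun x1 x2 => 1 - x2 - x1) (v := fun x1 _ => x1)).
- have D := PdegD (PdegD (PdegC 1 1) (PdegZ (-1) (@Pdeg_x2 R))) (PdegZ (-1) (@Pdeg_x1 R)).
  by apply: Pdeg_ext D => x y; ring.
- exact: Pdeg_x1.
move=> i j; rewrite (@int_triangle_ext _
    (fun x1 x2 => x1 ^+ j * x2 ^+ 0 * (1 - x1 - x2) ^+ i)).
  by rewrite int_triangle_barycentric fact0 mulr1 addn0 addnC [j`!%:R * _]mulrC.
by move=> x y; rewrite mulr1 mulrC; congr (_ * _ ^+ _); ring.
Qed.

Lemma int_triangle_MR n f : Pdeg n f -> int_triangle (MRop f) = int_triangle f.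
Proof.
move=> nf; rewrite -(int_triangle_RM (Pdeg_MR nf)); apply: int_triangle_ext => x y.
by rewrite /RMop /MRop /Rop /Mop; congr f; ring.
Qed.

(** The points 1/(k+3) are infinitely many and lie strictly between 0 and 1/2, so that pairs of them
    are interior points of the triangle. *)
Lemma horner_eq0_small p : (forall k : nat, p.[k.+3%:R^-1] = 0) -> p = 0 :> {poly R}.
Proof.
move=> p0; apply: (roots_geq_poly_eq0 (rs := [seq i.+3%:R^-1 | i <- iota 0 (size p)])).
- by apply/allP => _ /mapP[i _ ->]; rewrite /root p0.
- rewrite map_inj_uniq ?iota_uniq// => i j /invr_inj /eqP.
  by rewrite eqr_nat !eqSS => /eqP.
- by rewrite size_map size_iota.
Qed.

Lemma Pdeg_eq0_small n f : Pdeg n f ->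
  (forall j k : nat, f j.+3%:R^-1 k.+3%:R^-1 = 0) -> forall x y, f x y = 0.
Proof.
move=> nf f0 x y.
have fx j : f j.+3%:R^-1 y = 0.
  have [w wE] := Pdeg_horner j.+3%:R^-1%:P 'X nf.
  have w0 : w = 0 by apply: horner_eq0_small => k; rewrite wE hornerC hornerX.
  by have := wE y; rewrite hornerC hornerX w0 horner0 => <-.
have [w wE] := Pdeg_horner 'X y%:P nf.
have w0 : w = 0 by apply: horner_eq0_small => k; rewrite wE hornerC hornerX.
by have := wE x; rewrite hornerC hornerX w0 horner0 => <-.
Qed.

Lemma Pdeg_continuous n f : Pdeg n f -> continuous (fun z : R * R => f z.1 z.2).
Proof.
move: f; apply: Pdeg_ind.
- by move=> f g fg cf; rewrite (_ : (fun z => _) = (fun z => f z.1 z.2))//;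
    apply/funext => z; rewrite fg.
- by move=> z; exact: cvg_cst.
- by move=> f g _ _ cf cg z; apply: cvgD; [exact: cf|exact: cg].
- move=> c i j _ z; apply: cvgM; first apply: cvgM.
  + exact: cvg_cst.
  + by apply: (@continuous_comp _ _ _ fst (fun x : R => x ^+ i));
      [exact: cvg_fst|exact: exprn_continuous].
  + by apply: (@continuous_comp _ _ _ snd (fun x : R => x ^+ j));
      [exact: cvg_snd|exact: exprn_continuous].
Qed.

(** If [f] were nonzero at a grid point of [Pdeg_eq0_small], continuity would keep it nonzero on a
    product of two balls inside the triangle. That product has positive measure, whereas [f * f]
    vanishes almost everywhere. *)
Lemma int_triangle_sqr_eq0 n f : Pdeg n f ->
  int_triangle (fun x1 x2 => f x1 x2 * f x1 x2) = 0 -> forall x y, f x y = 0.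
Proof.
move=> nf f0; apply: (Pdeg_eq0_small nf) => j k; apply/eqP/negP => /negP fz.
have ff := Pdeg_integrable (PdegM nf nf).
have : (\int[mu2]_(z in T) `|(f z.1 z.2 * f z.1 z.2)%:E| = 0)%E.
  under eq_integral => z _ do rewrite gee0_abs ?lee_fin -?expr2 ?sqr_ge0//.
  rewrite -[LHS]fineK; first by congr EFin; rewrite -f0 /int_triangle /Rintegral.
  by apply: integrable_fin_num; [exact: measurable_triangle|exact: ff].
move=> /(ae_eq_integral_abs _ measurable_triangle)-/(_ (measurable_int _ ff)).
move=> [N [mN N0 TN]].
pose z0 : R * R := (j.+3%:R^-1, k.+3%:R^-1).
have in01 (l : nat) : 0 < (l.+3%:R^-1 : R) < 2^-1.
  by rewrite invr_gt0 ltr0n/= ltf_pV2 ?posrE ?ltr0n// ltr_nat.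
have sq : \forall z \near z0, f z.1 z.2 != 0 /\ (0 < z.1 < 2^-1) /\ (0 < z.2 < 2^-1).
  have c1 : (fst @ z0 --> z0.1)%classic by exact: cvg_fst.
  have c2 : (snd @ z0 --> z0.2)%classic by exact: cvg_snd.
  have /andP[j0 j2] := in01 j; have /andP[k0 k2] := in01 k.
  near=> z; split; [|split; apply/andP; split]; near: z.
  - exact: (cvgr_neq0 _ (Pdeg_continuous nf (x := z0))).
  - exact: (cvgr_gt _ c1).
  - exact: (cvgr_lt _ c1).
  - exact: (cvgr_gt _ c2).
  - exact: (cvgr_lt _ c2).
case: sq => -[A B] [/= /nbhs_ballP[a a0 aA] /nbhs_ballP[b b0 bB]] AB.
pose X : set M := ball (j.+3%:R^-1 : R) a; pose Y : set M := ball (k.+3%:R^-1 : R) b.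
have mX : measurable X by exact: measurable_ball.
have mY : measurable Y by exact: measurable_ball.
have : (mu2 (X `*` Y) <= mu2 N)%E.
  apply: le_measure; rewrite ?inE//.
    exact: measurableX.
  move=> [x y] [/= /aA Ax /bB By]; apply: TN => /= Tfz.
  have [/= fxy [/andP[x0 x1] /andP[y0 y1]]] := AB (x, y) (conj Ax By).
  have /Tfz [] : T (x, y).
    by split; [exact: ltW|split; [exact: ltW|rewrite /=; lra]].
  by move=> /eqP; rewrite mulf_eq0 orbb (negPf fxy).
have -> : (mu2 (X `*` Y) = (a *+ 2)%:E * (b *+ 2)%:E)%E.
  rewrite -(lebesgue_measure_ball (j.+3%:R^-1 : R) (ltW a0)).
  by rewrite -(lebesgue_measure_ball (k.+3%:R^-1 : R) (ltW b0)); exact: product_measure1E.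
rewrite N0.
by rewrite leNgt lte_fin mulr_gt0// mulrn_wgt0.
Unshelve. all: by end_near. Qed.

End IntegralTriangle.

(** * The space of polynomials orthogonal to all lower degrees *)

Section OrthogonalComplement.
Variable R : realType.
Set Implicit Arguments. Unset Strict Implicit.
Implicit Types f g q : R -> R -> R.

Lemma PperpP n f : Pperp n f <-> Pdeg n f /\
  forall q, (0 < n)%N -> Pdeg n.-1 q ->
    int_triangle (fun x1 x2 => f x1 x2 * q x1 x2) = 0.
Proof.
split=> -[nf fq]; split => // q n0 nq.
  by have := fq q n0 nq; rewrite (l2TE nf nq) => -[].
by rewrite (l2TE nf nq) fq.
Qed.

Lemma Pperp_ext n f g : f =2 g -> Pperp n f -> Pperp n g.
Proof.
move=> fg /PperpP[nf fq]; apply/PperpP; split; first exact: Pdeg_ext nf.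
move=> q n0 nq; rewrite -(fq q n0 nq); apply: int_triangle_ext => x y.
by rewrite fg.
Qed.

Lemma PperpD n f g : Pperp n f -> Pperp n g ->
  Pperp n (fun x1 x2 => f x1 x2 + g x1 x2).
Proof.
move=> /PperpP[nf fq] /PperpP[ng gq]; apply/PperpP; split; first exact: PdegD.
move=> q n0 nq; have := int_triangleD (PdegM nf nq) (PdegM ng nq).
rewrite fq// gq// addr0 => <-; apply: int_triangle_ext => x y.
by rewrite mulrDl.
Qed.

Lemma PperpZ n a f : Pperp n f -> Pperp n (fun x1 x2 => a * f x1 x2).
Proof.
move=> /PperpP[nf fq]; apply/PperpP; split; first exact: PdegZ.
move=> q n0 nq; have := int_triangleZ a (PdegM nf nq).
rewrite fq// mulr0 => <-; apply: int_triangle_ext => x y.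
by rewrite mulrA.
Qed.

Lemma Pperp0 n : Pperp n (fun _ _ : R => 0).
Proof.
apply/PperpP; split; first exact: Pdeg0.
move=> q _ _; rewrite -[RHS](int_triangle0 R); apply: int_triangle_ext => x y.
by rewrite mul0r.
Qed.

Lemma Pperp_sum n (I : Type) (r : seq I) (P : pred I) (F : I -> R -> R -> R) :
  (forall i, P i -> Pperp n (F i)) ->
  Pperp n (fun x1 x2 => \sum_(i <- r | P i) F i x1 x2).
Proof.
move=> nF; elim: r => [|i r IH].
  by apply: Pperp_ext (Pperp0 n) => x y; rewrite big_nil.
case Pi: (P i); last by apply: Pperp_ext IH => x y; rewrite big_cons Pi.
by apply: Pperp_ext (PperpD (nF i Pi) IH) => x y; rewrite big_cons Pi.
Qed.

Lemma RMopK f : RMop (MRop f) =2 f.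
Proof. by move=> x y; rewrite /RMop /MRop /Rop /Mop; congr f; ring. Qed.

Lemma MRopK f : MRop (RMop f) =2 f.
Proof. by move=> x y; rewrite /RMop /MRop /Rop /Mop; congr f; ring. Qed.

Lemma Pperp_R n f : Pperp n f -> Pperp n (Rop f).
Proof.
move=> /PperpP[nf fq]; apply/PperpP; split; first exact: Pdeg_R.
move=> q n0 nq; rewrite -(fq _ n0 (Pdeg_R nq)).
by rewrite -(int_triangle_R (PdegM nf (Pdeg_R nq))).
Qed.

(** Invariance of the integral makes the inverse MR the adjoint of RM, and MR preserves the degree
    of the test function. *)
Lemma Pperp_RM n f : Pperp n f -> Pperp n (RMop f).
Proof.
move=> /PperpP[nf fq]; apply/PperpP; split; first exact: Pdeg_RM.
move=> q n0 nq; rewrite -(fq _ n0 (Pdeg_MR nq)).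
rewrite -(int_triangle_RM (PdegM nf (Pdeg_MR nq))).
by apply: int_triangle_ext => x y; rewrite -(RMopK q x y).
Qed.

Lemma Pperp_MR n f : Pperp n f -> Pperp n (MRop f).
Proof.
move=> /PperpP[nf fq]; apply/PperpP; split; first exact: Pdeg_MR.
move=> q n0 nq; rewrite -(fq _ n0 (Pdeg_RM nq)).
rewrite -(int_triangle_MR (PdegM nf (Pdeg_RM nq))).
by apply: int_triangle_ext => x y; rewrite -(MRopK q x y).
Qed.

(** Unless [f] is already zero, a vanishing leading form lowers its degree to [n.-1]; then [f] is
    its own test function and its square has integral zero. *)
Lemma Pperp_leading_form_eq0 n f : Pperp n f ->
  leading_form n f (fun _ _ => 0) -> forall x y, f x y = 0.
Proof.
move=> /PperpP[nf fq] l0; have [[n0 nf']|//] := leading_form_eq0 nf l0.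
exact: int_triangle_sqr_eq0 nf (fq f n0 nf').
Qed.

End OrthogonalComplement.

(** * Jacobi polynomials: leading coefficients and orthogonality *)

Section ShiftedJacobi.
Variable R : realType.
Set Implicit Arguments. Unset Strict Implicit.
Implicit Types p q : {poly R}.

(* The shifted Jacobi polynomial, of argument [2 * 'X - 1]. *)
Definition sjacobi (b m : nat) : {poly R} :=
  \sum_(i < m.+1) ('C(m, m - i) * 'C(m + b, i))%:R *: (('X - 1) ^+ i * 'X^(m - i)).

Lemma horner_sjacobi b m s : (jacobi R 0 b m).[2 * s - 1] = (sjacobi b m).[s].
Proof.
rewrite /jacobi /sjacobi !horner_sum; apply: eq_bigr => i _.
rewrite addn0 !hornerZ !hornerM !horner_exp !hornerE.
have -> : 2^-1 * (2 * s - 1 - 1) = s - 1 by field.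
by have -> : 2^-1 * (2 * s - 1 + 1) = s by field.
Qed.

Lemma exp_top p k : (size p <= 2)%N ->
  (size (p ^+ k)%R <= k.+1)%N /\ (p ^+ k)`_k = p`_1 ^+ k.
Proof.
move=> sp; elim: k => [|k [IH1 IH2]]; first by rewrite size_poly1 coef1.
rewrite !exprS -IH2; split; first exact: (size_mul_top (i := 1)).
exact: (coef_mul_top (i := 1)).
Qed.

(** Each summand is a product of [m] factors of degree at most one, so its coefficient of degree [m]
    is the product of their slopes. *)
Lemma bernstein_top p q m (c : nat -> R) : (size p <= 2)%N -> (size q <= 2)%N ->
  let F := \sum_(i < m.+1) c i *: (p ^+ i * q ^+ (m - i)) in
  (size F <= m.+1)%N /\ F`_m = \sum_(i < m.+1) c i * (p`_1 ^+ i * q`_1 ^+ (m - i)).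
Proof.
move=> sp sq F.
have pq (i : 'I_m.+1) : (size (p ^+ i * q ^+ (m - i))%R <= m.+1)%N /\
    (p ^+ i * q ^+ (m - i))`_m = p`_1 ^+ i * q`_1 ^+ (m - i).
  have [sp1 p1] := exp_top i sp; have [sq1 q1] := exp_top (m - i) sq.
  have im : (i + (m - i))%N = m by rewrite subnKC// -ltnS.
  have := size_mul_top sp1 sq1; have := coef_mul_top sp1 sq1.
  by rewrite im p1 q1.
split.
  rewrite (leq_trans (size_sum _ _ _))//; apply/bigmax_leqP => i _.
  rewrite (leq_trans (size_scale_leq _ _))//.
  by have [] := pq i.
by rewrite coef_sum; apply: eq_bigr => i _; rewrite coefZ; have [_ ->] := pq i.
Qed.

Lemma size_linear (a c : R) : (size (a *: ('X + c%:P))%R <= 2)%N.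
Proof.
rewrite (leq_trans (size_scale_leq _ _))// (leq_trans (size_polyD _ _))//.
by rewrite size_polyX geq_max/= (leq_trans (size_polyC_leq1 _)).
Qed.

Lemma coef_linear (a c : R) : (a *: ('X + c%:P))`_1 = a.
Proof. by rewrite coefZ coefD coefX coefC/= addr0 mulr1. Qed.

Lemma sum_bin_neq0 a b m :
  \sum_(i < m.+1) ('C(m + a, m - i) * 'C(m + b, i))%:R != 0 :> R.
Proof.
rewrite -natr_sum pnatr_eq0 -lt0n big_ord_recl/= subn0 bin0 muln1.
by rewrite ltn_addr// bin_gt0 leq_addr.
Qed.

Lemma jacobi_top a b m :
  (size (jacobi R a b m) <= m.+1)%N /\ (jacobi R a b m)`_m != 0.
Proof.
have := bernstein_top m (fun i => ('C(m + a, m - i) * 'C(m + b, i))%:R)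
  (size_linear 2^-1 (-1)) (size_linear 2^-1 1).
rewrite !coef_linear polyCN => -[sj jE]; split; first exact: sj.
have -> : (jacobi R a b m)`_m = 2^-1 ^+ m *
    \sum_(i < m.+1) ('C(m + a, m - i) * 'C(m + b, i))%:R.
  rewrite [LHS]jE mulr_sumr; apply: eq_bigr => i _.
  by rewrite -exprD subnKC -1?ltnS// mulrC.
by rewrite mulf_neq0 ?sum_bin_neq0// expf_neq0// invr_neq0// pnatr_eq0.
Qed.

Lemma sjacobi_top b m : (size (sjacobi b m) <= m.+1)%N /\ (sjacobi b m)`_m != 0.
Proof.
have := bernstein_top m (fun i => ('C(m, m - i) * 'C(m + b, i))%:R)
  (size_linear 1 (-1)) (size_linear 1 0).
rewrite !coef_linear polyCN !scale1r addr0 => -[sj jE]; split; first exact: sj.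
have -> : (sjacobi b m)`_m = \sum_(i < m.+1) ('C(m + 0, m - i) * 'C(m + b, i))%:R.
  rewrite [LHS]jE; apply: eq_bigr => i _.
  by rewrite addn0 !expr1n !mulr1.
exact: sum_bin_neq0.
Qed.

(** One step of finite differences: Pascal's rule and an index shift turn the difference of order m
    + 1 of [g] into the difference of order m of its first difference. *)
Lemma alternating_sum_pascal (g : nat -> R) m :
  \sum_(i < m.+2) (-1) ^+ i * 'C(m.+1, i)%:R * g i =
  \sum_(i < m.+1) (-1) ^+ i * 'C(m, i)%:R * (g i - g i.+1).
Proof.
rewrite (eq_bigr (fun i : 'I_m.+2 => (-1) ^+ i * 'C(m, i)%:R * g i
    + (-1) ^+ i * ('C(m.+1, i) - 'C(m, i))%:R * g i)) => [|[[|i] ilt] _]; last first.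
- by rewrite binS addKn -mulrDl -mulrDr -natrD addnC.
- by rewrite !bin0 subnn mulr0 mul0r addr0.
rewrite big_split/= big_ord_recr/= bin_small// mulr0 mul0r addr0.
rewrite [X in _ + X]big_ord_recl/= !bin0 subnn mulr0 mul0r add0r -big_split/=.
by apply: eq_bigr => i _; rewrite binS addKn exprS; ring.
Qed.

(** The last binomial is a polynomial of degree [r] in [i], killed by a difference of order m > r.
    Each step lowers [m] and [r] together by Pascal's rule; [m <= M] keeps the subtraction exact. *)
Lemma alternating_sum_bin m M r : (r < m <= M)%N ->
  \sum_(i < m.+1) (-1) ^+ i * 'C(m, i)%:R * 'C(M + r - i, r)%:R = 0 :> R.
Proof.
elim: m r => [|m IH] r; first by rewrite ltn0.
move=> /andP[rm mM]; rewrite (alternating_sum_pascal (fun i => 'C(M + r - i, r)%:R)).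
case: r => [|r] in rm *.
  by rewrite big1// => i _; rewrite !bin0 subrr mulr0.
have rmM : (r < m <= M)%N by rewrite -ltnS rm ltnW.
rewrite -[RHS](IH r rmM); apply: eq_bigr => -[i ilt] _ /=.
have -> : (M + r.+1 - i = (M + r - i).+1)%N by lia.
have -> : (M + r.+1 - i.+1 = M + r - i)%N by lia.
by rewrite binS natrD [X in X - _]addrC addrK.
Qed.

(** Rewrites the factorials of a beta integral so that [i] survives only in the binomial of
    [alternating_sum_bin]. *)
Lemma bin_fact_shift M r i : (i <= M)%N ->
  ('C(M, i) * ((M + r - i)`! * i`!) = M`! * r`! * 'C(M + r - i, r))%N.
Proof.
move=> iM; apply/eqP; rewrite -(eqn_pmul2r (fact_gt0 (M - i))); apply/eqP.
have e1 := bin_fact iM.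
have rM : (r <= M + r - i)%N by lia.
have := bin_fact rM; have -> : (M + r - i - r = M - i)%N by lia.
by move=> e2; rewrite -{1}e2 -e1; lia.
Qed.

(** The factor X^b is, up to a constant, the Jacobi weight shifted to [0, 1]. Termwise beta
    integrals yield a constant times the alternating sum with M = m + b. *)
Lemma int01_sjacobi_Xn b m r : (r < m)%N -> int01 ('X^(b + r) * sjacobi b m) = 0.
Proof.
move=> rm; rewrite mulr_sumr int01_sum.
rewrite (eq_bigr (fun i : 'I_m.+1 => ((m + b)`! * r`!)%:R / (m + b + r).+1`!%:R
   * ((-1) ^+ i * 'C(m, i)%:R * 'C(m + b + r - i, r)%:R))) => [|[i ilt] _ /=].
  by rewrite -mulr_sumr alternating_sum_bin ?mulr0// rm leq_addr.
have im : (i <= m)%N by [].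
rewrite -scalerAr int01Z.
have -> : 'X^(b + r) * (('X - 1) ^+ i * 'X^(m - i)) =
    (-1) ^+ i *: ('X^(m + b + r - i) * (1 - 'X) ^+ i) :> {poly R}.
  have -> : (m + b + r - i = (b + r) + (m - i))%N by lia.
  rewrite -(opprB 1 'X) (exprNn (1 - 'X)) -mul_polyC polyC_exp polyCN polyC1.
  by rewrite (exprD _ (b + r)); ring.
rewrite int01Z int01_beta; have -> : (m + b + r - i + i = m + b + r)%N by lia.
have e := bin_fact_shift r (leq_trans im (leq_addr b m)).
rewrite bin_sub// mulrCA (mulrA _ _ (_^-1)) -natrM -mulnA e.
by rewrite 3!natrM; ring.
Qed.

Lemma int01_sjacobi b m p : (size p <= m)%N -> int01 ('X^b * p * sjacobi b m) = 0.
Proof.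
have := @int01_sjacobi_Xn b m; move: (sjacobi b m) => J J0 sp.
rewrite -[p]coefK poly_def mulr_sumr mulr_suml int01_sum big1// => -[i ilt] _ /=.
rewrite -scalerAr -scalerAl int01Z -exprD J0 ?mulr0//.
exact: leq_trans ilt sp.
Qed.

Lemma int01_XnM d p n : (size p <= n)%N ->
  int01 ('X^d * p) = \sum_(l < n) p`_l / (l + d).+1%:R.
Proof.
move=> sp; have -> : 'X^d * p = \sum_(l < n) p`_l *: 'X^(l + d).
  apply: poly_ext => x; rewrite hornerM hornerXn (horner_coef_wide _ sp) horner_sum.
  by rewrite mulr_sumr; apply: eq_bigr => i _; rewrite hornerZ hornerXn exprD; ring.
by rewrite int01_sum; apply: eq_bigr => l _; rewrite int01Z int01_Xn.
Qed.

End ShiftedJacobi.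

(** * The polynomials b_{n,k}: orthogonality, leading forms and parity *)

Section TriangleBasis.
Variable R : realType.
Set Implicit Arguments. Unset Strict Implicit.
Implicit Types (f g q : R -> R -> R) (p h : {poly R}).

Lemma int_triangle_sum n (I : Type) (r : seq I) (P : pred I) (F : I -> R -> R -> R) :
  (forall i, P i -> Pdeg n (F i)) ->
  int_triangle (fun x1 x2 => \sum_(i <- r | P i) F i x1 x2)
    = \sum_(i <- r | P i) int_triangle (F i).
Proof.
move=> nF; elim: r => [|i r IH].
  rewrite big_nil -[RHS](int_triangle0 R); apply: int_triangle_ext => x y.
  by rewrite big_nil.
rewrite big_cons; case Pi: (P i); last first.
  by rewrite -IH; apply: int_triangle_ext => x y; rewrite big_cons Pi.
rewrite -IH -(int_triangleD (nF i Pi) (Pdeg_sum r nF)).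
by apply: int_triangle_ext => x y; rewrite big_cons Pi.
Qed.

(** In the coordinates s = x + y and u = x / s, with Jacobian s, a form of degree [d] gives the
    integral of s^(d+1), that is 1/(d+2), times an integral along the edge x + y = 1. This is
    checked on monomials by beta integrals. *)
Lemma int_triangle_form d h w : (forall u, w.[u] = binary_form d h u (1 - u)) ->
  int_triangle (binary_form d h) = int01 w / d.+2%:R.
Proof.
move=> wE; rewrite (int_triangle_sum (n := d)) => [|[i ilt] _]; last first.
  by apply: Pdeg_monomial; rewrite /= subnKC.
have -> : w = \sum_(i < d.+1) h`_i *: ('X^i * (1 - 'X) ^+ (d - i)).
  apply: poly_ext => u; rewrite wE horner_sum; apply: eq_bigr => i _.
  by rewrite !hornerE/=; ring.
rewrite int01_sum mulr_suml; apply: eq_bigr => -[i ilt] _ /=.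
rewrite int_triangle_monomial int01Z int01_beta subnKC// factSr.
by rewrite -(nat1r d.+1); field; rewrite factr_neq0 !nat1r pnatr_eq0.
Qed.

Lemma int_triangle_homogeneous d f w : Pdeg d f ->
  (forall t x y, f (t * x) (t * y) = t ^+ d * f x y) ->
  (forall u, w.[u] = f u (1 - u)) ->
  int_triangle f = int01 w / d.+2%:R.
Proof.
move=> df hf wE; have [h _ fE] := homogeneous_form df hf.
by rewrite (int_triangle_ext fE); apply: int_triangle_form => u; rewrite wE.
Qed.

Lemma Pdeg_x1Dx2 : Pdeg 1 (fun x1 x2 : R => x1 + x2).
Proof. exact: PdegD (@Pdeg_x1 R) (@Pdeg_x2 R). Qed.

Lemma Pdeg_x1Bx2 : Pdeg 1 (fun x1 x2 : R => x1 - x2).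
Proof.
by apply: Pdeg_ext (PdegD (@Pdeg_x1 R) (PdegZ (-1) (@Pdeg_x2 R))) => x y; ring.
Qed.

Lemma Pdeg_homog k p : Pdeg k (homog k p).
Proof.
apply: Pdeg_sum => -[i ilt] _ /=.
have := PdegM (PdegZ p`_i (PdegX i Pdeg_x1Bx2)) (PdegX (k - i) Pdeg_x1Dx2).
by rewrite !muln1 subnKC.
Qed.

Lemma homog_homogeneous k p t x y : homog k p (t * x) (t * y) = t ^+ k * homog k p x y.
Proof.
rewrite /homog mulr_sumr; apply: eq_bigr => -[i ilt] _ /=.
have -> : t ^+ k = t ^+ i * t ^+ (k - i) by rewrite -exprD subnKC.
by rewrite -mulrBr -mulrDr !exprMn; ring.
Qed.

Lemma homog_sum1 k p x y : (size p <= k.+1)%N -> x + y = 1 ->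
  homog k p x y = p.[x - y].
Proof.
move=> sp xy; rewrite (horner_coef_wide _ sp); apply: eq_bigr => i _.
by rewrite xy expr1n mulr1.
Qed.

(** Splits b_{n,k} into homogeneous layers of degree l + k, to which [int_triangle_homogeneous] and
    [leading_form_homogeneous] apply. *)
Lemma bnkE n k x y : bnk n k x y =
  \sum_(l < (n - k).+1) (sjacobi R (2 * k + 1) (n - k))`_l *
     ((x + y) ^+ l * homog k (legendre R k) x y).
Proof.
have [sj _] := sjacobi_top R (2 * k + 1) (n - k).
rewrite /bnk horner_sjacobi (horner_coef_wide _ sj) mulr_suml.
by apply: eq_bigr => l _; rewrite mulrA.
Qed.

Lemma Pdeg_layer k l :
  Pdeg (l + k) (fun x y => (x + y) ^+ l * homog k (legendre R k) x y).
Proof.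
by have := PdegM (PdegX l Pdeg_x1Dx2) (Pdeg_homog k (legendre R k)); rewrite muln1.
Qed.

Lemma layer_homogeneous k l t x y :
  (t * x + t * y) ^+ l * homog k (legendre R k) (t * x) (t * y)
  = t ^+ (l + k) * ((x + y) ^+ l * homog k (legendre R k) x y).
Proof. by rewrite homog_homogeneous -mulrDr exprMn exprD; ring. Qed.

Lemma Pdeg_bnk n k : (k <= n)%N -> Pdeg n (bnk (R := R) n k).
Proof.
move=> kn; apply: (Pdeg_ext (fun x y => esym (bnkE n k x y))).
apply: Pdeg_sum => -[l llt] _; apply: PdegZ; apply: Pdeg_leq (Pdeg_layer k l).
by rewrite /=; lia.
Qed.

Lemma leading_form_bnk n k : (k <= n)%N ->
  leading_form n (bnk (R := R) n k) (fun x y =>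
    (sjacobi R (2 * k + 1) (n - k))`_(n - k) *
      ((x + y) ^+ (n - k) * homog k (legendre R k) x y)).
Proof.
move=> kn; have lf l := leading_form_homogeneous (Pdeg_layer k l) (@layer_homogeneous k l).
have [sj _] := sjacobi_top R (2 * k + 1) (n - k).
apply: (leading_form_ext (f := fun x y => \sum_(l < (n - k).+1)
    (sjacobi R (2 * k + 1) (n - k))`_l * ((x + y) ^+ l * homog k (legendre R k) x y))
  (H := fun x y => \sum_(l < (n - k).+1) if l == ord_max then
    (sjacobi R (2 * k + 1) (n - k))`_l * ((x + y) ^+ l * homog k (legendre R k) x y)
    else 0)).
- by move=> x y; rewrite bnkE.
- by move=> x y; rewrite -big_mkcond/= big_pred1_eq.
(* Only the top layer l = n - k reaches degree [n]. *)
apply: leading_form_sum => l _; case: eqP => [->/=|/eqP lmax].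
  by apply: leading_formZ; have := lf (n - k)%N; rewrite subnK.
apply: leading_form_lt (leading_formZ _ (lf l)).
have := ltn_ord l; move: lmax; rewrite -val_eqE/=; lia.
Qed.

(** Against a monomial of degree i + j < n the integral factors into an angular and a radial part.
    If i + j < k, Legendre orthogonality kills the angular part. Otherwise the radial exponent k + i
    + j + 1 is 2k + 1 plus i + j - k < n - k, and Jacobi orthogonality kills the radial part. *)
Lemma Pperp_bnk n k : (k <= n)%N -> Pperp n (bnk (R := R) n k).
Proof.
move=> kn; apply/PperpP; split; first exact: Pdeg_bnk.
move=> q n0; move: q; apply: Pdeg_ind.
- move=> f g fg <-; apply: int_triangle_ext => x y.
  by rewrite fg.
- rewrite -[RHS](int_triangle0 R); apply: int_triangle_ext => x y.
  by rewrite mulr0.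
- move=> f g nf ng f0 g0; have bn := Pdeg_bnk kn.
  have := int_triangleD (PdegM bn nf) (PdegM bn ng); rewrite f0 g0 addr0 => <-.
  by apply: int_triangle_ext => x y; rewrite mulrDr.
move=> c i j ij.
pose J := sjacobi R (2 * k + 1) (n - k); have [sJ _] := sjacobi_top R (2 * k + 1) (n - k).
(* [w] is the restriction of the integrand to the edge x + y = 1, with u = x; it is the same for
   every layer. *)
pose w := sjacobi R 0 k * ('X^i * (1 - 'X) ^+ j).
pose F l x y : R := (x + y) ^+ l * homog k (legendre R k) x y * (1 * x ^+ i * y ^+ j).
have PF l : Pdeg (l + k + (i + j)) (F l).
  exact: PdegM (Pdeg_layer k l) (Pdeg_monomial 1 (leqnn _)).
have iF l : int_triangle (F l) = int01 w / (l + k + (i + j)).+2%:R.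
  apply: int_triangle_homogeneous => [//|t x y|u].
    by rewrite /F layer_homogeneous !exprMn [t ^+ (_ + (i + j))]exprD (exprD t i j); ring.
  have [sl _] := jacobi_top R 0 0 k.
  rewrite /F homog_sum1//; last by ring.
  have -> : u - (1 - u) = 2 * u - 1 by ring.
  rewrite horner_sjacobi /w hornerM; have -> : u + (1 - u) = 1 by ring.
  by rewrite expr1n !hornerE/=; ring.
have bE x y : bnk n k x y * (c * x ^+ i * y ^+ j) =
    \sum_(l < (n - k).+1) (c * J`_l) * F l x y.
  by rewrite bnkE mulr_suml; apply: eq_bigr => l _; rewrite /F /J; ring.
rewrite (int_triangle_ext bE).
rewrite (int_triangle_sum (n := n + (i + j))) => [|[l llt] _]; last first.
  by apply: PdegZ; apply: Pdeg_leq (PF l); rewrite /=; lia.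
rewrite (eq_bigr (fun l : 'I_(n - k).+1 =>
    c * int01 w * (J`_l / (l + (k + i + j).+1).+1%:R)))
  => [|l _]; last first.
  rewrite (int_triangleZ _ (PF l)) iF.
  have -> : (l + k + (i + j)).+2 = (l + (k + i + j).+1).+1 by lia.
  by ring.
rewrite -mulr_sumr -(int01_XnM _ sJ).
have [ijk|kij] := ltnP (i + j) k.
  suff -> : int01 w = 0 by rewrite mulr0 mul0r.
  rewrite /w mulrC -['X^i * _]mul1r -(expr0 'X); apply: int01_sjacobi.
  have [sX _] := exp_top j (size_linear (-1 : R) (-1)).
  have -> : 1 - 'X = -1 *: ('X + (-1)%:P) :> {poly R}.
    by rewrite polyCN scaleN1r opprD opprK addrC.
  by rewrite (leq_trans _ ijk)// size_mul_top// size_polyXn.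
suff -> : int01 ('X^((k + i + j).+1) * J) = 0 by rewrite mulr0.
have -> : (k + i + j).+1 = (2 * k + 1 + (i + j - k))%N by lia.
by apply: int01_sjacobi_Xn; lia.
Qed.

(** Evenness means that the factor (-1)^i does not change the i-th coefficient, which absorbs the
    sign change of x - y. *)
Lemma homog_even k p x y : (forall t, p.[- t] = p.[t]) -> homog k p y x = homog k p x y.
Proof.
move=> pN; have pE : p = \poly_(i < size p) ((-1) ^+ i * p`_i).
  apply: poly_ext => t; rewrite -pN horner_poly horner_coef; apply: eq_bigr => i _.
  by rewrite (exprNn t); ring.
apply: eq_bigr => i _; rewrite -(opprB x y) exprNn (addrC y).
suff pi : (-1) ^+ i * p`_i = p`_i by rewrite -[in RHS]pi; ring.
rewrite [in RHS]pE coef_poly; case: ltnP => // ip.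
by rewrite nth_default// mulr0.
Qed.

(** Reversing the summation exchanges the factors t - 1 and t + 1, and each of the [k] linear
    factors changes sign. *)
Lemma legendre_opp k t : (legendre R k).[- t] = (-1) ^+ k * (legendre R k).[t].
Proof.
rewrite /legendre /jacobi !horner_sum mulr_sumr (reindex_inj rev_ord_inj)/=.
apply: eq_bigr => -[i ilt] _ /=.
have ik : (i <= k)%N by [].
rewrite subSS subKn// addn0 !hornerZ !hornerM !horner_exp !hornerE.
have -> : 2^-1 * (- t - 1) = - (2^-1 * (t + 1)) by ring.
have -> : 2^-1 * (- t + 1) = - (2^-1 * (t - 1)) by ring.
rewrite (exprNn (2^-1 * (t + 1))) (exprNn (2^-1 * (t - 1))) mulnC.
have -> : (-1) ^+ k = (-1) ^+ (k - i) * (-1) ^+ i :> R by rewrite -exprD subnK.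
by rewrite /=; ring.
Qed.

Lemma bnk_even_sym n k x y : bnk n (2 * k) y x = bnk n (2 * k) x y :> R.
Proof.
rewrite /bnk (addrC y) homog_even// => t.
by rewrite legendre_opp exprM sqrrN !expr1n mul1r.
Qed.

End TriangleBasis.

(** * Binary forms under the symmetries, and the reflection identity *)

Section SymmetricForms.
Variable R : realType.
Set Implicit Arguments. Unset Strict Implicit.
Implicit Types (f g H G U V : R -> R -> R) (h p : {poly R}).

(** At y = 1 the lines x = 0, y = 0 and x + y = 0 correspond to the factor X, a drop in degree and
    the factor X + 1. The vanishing low coefficients give X^m, symmetry turns them into the degree
    bound 2m, and X^m (X+1)^m already has degree 2m, so the quotient is constant. *)
Lemma three_lines n m h : (size h <= n.+1)%N -> (n <= 3 * m)%N ->
  (forall i, (i <= n)%N -> h`_i = h`_(n - i)) ->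
  (forall j, (j < m)%N -> h`_j = 0) ->
  ('X - (-1)%:P) ^+ m %| h ->
  exists c, h = c *: ('X^m * ('X - (-1)%:P) ^+ m).
Proof.
move=> sh nm hsym hlow hdiv.
have sh' : (size h <= (2 * m).+1)%N.
  apply/leq_sizeP => i im; have [ni|ni] := ltnP n i.
    by rewrite nth_default// (leq_trans sh).
  by rewrite hsym// hlow//; lia.
have Xh : 'X^m %| h.
  rewrite -(poly_take_drop m h) dvdp_addr ?dvdp_mull//.
  suff -> : take_poly m h = 0 by rewrite dvdp0.
  by apply/polyP => j; rewrite coef_take_poly coef0; case: ltnP => // /hlow.
have cop : coprimep 'X^m (('X - (-1)%:P : {poly R}) ^+ m).
  apply: coprimep_expl; apply: coprimep_expr.
  by rewrite coprimep_XsubC /root hornerX oppr_eq0 oner_eq0.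
have /dvdpP[q hE] : 'X^m * ('X - (-1)%:P) ^+ m %| h by rewrite Gauss_dvdp// Xh.
have [q0|q0] := eqVneq q 0; first by exists 0; rewrite hE q0 mul0r scale0r.
have Dn0 : 'X^m * ('X - (-1)%:P) ^+ m != 0 :> {poly R}.
  by rewrite mulf_neq0 ?expf_neq0 ?polyX_eq0 ?polyXsubC_eq0.
have sD : size ('X^m * ('X - (-1)%:P) ^+ m : {poly R}) = (2 * m).+1.
  rewrite size_mul ?expf_neq0 ?polyX_eq0 ?polyXsubC_eq0// size_polyXn size_exp_XsubC.
  by lia.
have /size1_polyC qE : (size q <= 1)%N.
  move: sh'; rewrite hE size_mul// sD addnS/= -[X in (_ <= X)%N]add1n.
  by rewrite leq_add2r.
by exists q`_0; rewrite {1}hE {1}qE mul_polyC.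
Qed.

Lemma binary_form_sym n h : (size h <= n.+1)%N ->
  (forall x y, binary_form n h x y = binary_form n h y x) ->
  forall i, (i <= n)%N -> h`_i = h`_(n - i).
Proof.
move=> sh hs i ilt; pose k := \poly_(i < n.+1) h`_(n - i).
suff kh : k = h by rewrite -{1}kh coef_poly ltnS ilt.
apply: (binary_form_inj (size_poly _ _) sh) => x; rewrite [RHS]hs.
rewrite [RHS]/binary_form (reindex_inj rev_ord_inj); apply: eq_bigr => -[l llt] _ /=.
rewrite subSS coef_poly llt subKn//; ring.
Qed.

(** The symmetries carry divisibility by (x + y)^m to the other two lines, and the product of the
    three powers has degree 3m > n. *)
Lemma invariant_form_eq0 n m r h G : (size h <= n.+1)%N -> (n < 3 * m)%N ->
  Pdeg r G ->
  (forall x y, binary_form n h x y = binary_form n h y x) ->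
  (forall x y, binary_form n h x y = binary_form n h y (- x - y)) ->
  (forall x y, binary_form n h x y = (x + y) ^+ m * G x y) -> h = 0.
Proof.
move=> sh nm rG hxy hrot hG; have hsym := binary_form_sym sh hxy.
have hlow j : (j < m)%N -> h`_j = 0.
  (* The rotated point (1, -x-1) has coordinate sum -x, which makes X^m a factor of [h]. *)
  have [w wE] := Pdeg_horner 1 (- 'X - 1) rG.
  have -> : h = 'X^m * ((-1) ^+ m *: w).
    apply: poly_ext => x; rewrite -(binary_form1 _ sh) hrot hG.
    have -> : 1 + (- x - 1) = - x by ring.
    by rewrite hornerM hornerXn hornerZ wE !hornerE/= (exprNn x); ring.
  by move=> jm; rewrite coefXnM jm.
have [c hE] : exists c, h = c *: ('X^m * ('X - (-1)%:P) ^+ m).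
  apply: (three_lines sh (ltnW nm)) => //.
  have [w wE] := Pdeg_horner 'X 1 rG.
  have -> : h = ('X - (-1)%:P) ^+ m * w.
    apply: poly_ext => x; rewrite -(binary_form1 _ sh) hG.
    by rewrite hornerM horner_exp wE !hornerE opprK.
  exact: dvdp_mulr.
(* The constant [c] is the coefficient of degree 2m. Either 2m exceeds [n], or symmetry equates it
   with the coefficient of degree n - 2m < m; it is zero in both cases. *)
have hc : h`_(m + m) = c.
  have sL : (size ('X - (-1)%:P : {poly R})%R <= 2)%N by rewrite size_XsubC.
  have [sLm Lm] := exp_top m sL.
  rewrite hE coefZ coef_mul_top ?size_polyXn// Lm coefXn eqxx coefB coefX coefC subr0.
  by rewrite expr1n !mulr1.
rewrite hE -hc; suff -> : h`_(m + m) = 0 by rewrite scale0r.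
have [mn|mn] := leqP (m + m) n; first by rewrite hsym// hlow//; lia.
by rewrite nth_default// (leq_trans sh).
Qed.

(** The identity expresses [h] by its two rotates, which supplies the missing divisibility by (x +
    y)^m; what remains is a multiple of an invariant form. *)
Lemma refl_form_eq0 n m h : (size h <= n.+1)%N -> (n <= 3 * m)%N ->
  (forall x y, binary_form n h x y = binary_form n h y x) ->
  (forall x y, binary_form n h (- x - y) x + binary_form n h y (- x - y)
     = - binary_form n h x y) ->
  (forall j, (j < m)%N -> h`_j = 0) -> h = 0.
Proof.
move=> sh nm hsym hrefl hlow.
suff [c hE] : exists c, h = c *: ('X^m * ('X - (-1)%:P) ^+ m).
  (* At (1, 1) and at its rotates (-2, 1) and (1, -2) the form takes the same value c 2^m, so three
     times this value is zero. *)
  have := hrefl 1 1; rewrite [X in _ + X]hsym !binary_form1// hE hornerZ hornerZ.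
  rewrite !hornerM !hornerXn !horner_exp !hornerXsubC expr1n -exprMn mul1r opprK.
  have -> : (- 1 - 1) * (- 1 - 1 + 1) = 1 + 1 :> R by ring.
  move=> c3; have /eqP : c * (1 + 1) ^+ m = 0 by lra.
  rewrite mulf_eq0 expf_eq0 [1 + 1 == 0](pnatr_eq0 R 2) andbF orbF => /eqP ->.
  by rewrite scale0r.
apply: (three_lines sh nm) => //; first exact: binary_form_sym.
pose L : {poly R} := 'X - (-1)%:P.
(* The sums are the two rotates at y = 1, where [- L] is the third coordinate. Terms with an
   exponent of [- L] below [m] have coefficient zero, in the second sum by symmetry. *)
have -> : h = - (\sum_(i < n.+1) h`_i *: ((- L) ^+ i * 'X^(n - i))
    + \sum_(i < n.+1) h`_i *: (- L) ^+ (n - i)).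
  apply: poly_ext => x; rewrite -(binary_form1 _ sh) -[LHS]opprK -hrefl hornerN.
  have Lx : (- L).[x] = - x - 1 by rewrite /L !hornerE/=; ring.
  congr (- _); rewrite hornerD !horner_sum; congr (_ + _); apply: eq_bigr => i _.
    by rewrite hornerZ hornerM horner_exp hornerXn Lx; ring.
  by rewrite hornerZ horner_exp Lx expr1n; ring.
have Ldiv l : (m <= l)%N -> L ^+ m %| (- L) ^+ l.
  by move=> ml; rewrite exprNn dvdp_mull// dvdp_exp2l.
have Lsum (F : 'I_n.+1 -> {poly R}) : (forall i, L ^+ m %| F i) ->
    L ^+ m %| \sum_(i < n.+1) F i.
  move=> LF; apply: (big_ind (fun p => L ^+ m %| p)) => [||i _]; rewrite ?dvdp0 ?LF//.
  exact: dvdp_add.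
rewrite dvdpNr dvdp_add//; apply: Lsum => -[i ilt] /=; rewrite -mul_polyC.
- have [im|mi] := ltnP i m; first by rewrite hlow// mul0r dvdp0.
  by rewrite dvdp_mull// dvdp_mulr// Ldiv.
- have [im|mi] := ltnP (n - i) m; last by rewrite dvdp_mull// Ldiv.
  by rewrite (binary_form_sym sh hsym)// hlow// mul0r dvdp0.
Qed.

(** The system is triangular: only the last term contributes to the top even degree, and induction
    removes it. *)
Lemma free_distinct_size (p : nat -> {poly R}) N (c : nat -> R) :
  (forall k, (size (p k) <= (2 * k).+1)%N /\ (p k)`_(2 * k) != 0) ->
  \sum_(k < N) c k *: p k = 0 -> forall k, (k < N)%N -> c k = 0.
Proof.
move=> pP; elim: N => [//|N IH]; rewrite big_ord_recr/= => sum0.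
have cN : c N = 0.
  have := congr1 (fun q : {poly R} => q`_(2 * N)) sum0.
  rewrite coefD coefZ coef0 coef_sum big1 => [|[k klt] _ /=].
    by rewrite add0r => /eqP; rewrite mulf_eq0 (negPf (pP N).2) orbF => /eqP.
  by rewrite coefZ nth_default ?mulr0// (leq_trans (pP k).1)//; lia.
move: sum0; rewrite cN scale0r addr0 => /IH IH' k.
by rewrite ltnS leq_eqVlt => /predU1P[->|/IH'].
Qed.

Lemma RMopE f x y : RMop f x y = f (1 - x - y) x.
Proof. by rewrite /RMop /Rop /Mop; congr f; ring. Qed.

Lemma PiopE f x y :
  Piop f x y = 3^-1 * (2 * f x y - f y (1 - x - y) - f (1 - x - y) x).
Proof. by rewrite /Piop RMopE. Qed.

Definition swap_invariant f := forall x y, f x y = f y x.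
Definition reflection f := forall x y, RMop f x y + MRop f x y = - f x y.

Lemma reflectionE f : reflection f <->
  forall x y, f (1 - x - y) x + f y (1 - x - y) = - f x y.
Proof. by split=> fr x y; have := fr x y; rewrite RMopE. Qed.

(** A pair of equations, so that one rewrite simplifies both coordinates of a twice rotated
    point. *)
Lemma barycentric_rotK (x y : R) : (1 - (1 - x - y) - x = y) * (1 - y - (1 - x - y) = x).
Proof. by split; ring. Qed.

Lemma reflection_Pi f : reflection (Piop f).
Proof. by apply/reflectionE => x y; rewrite !PiopE !barycentric_rotK; field. Qed.

Lemma reflection_RM f : reflection f -> reflection (RMop f).
Proof.
move=> /reflectionE fr; apply/reflectionE => x y.
by have := fr (1 - x - y) x; rewrite !RMopE !barycentric_rotK.
Qed.

Lemma reflection_MR f : reflection f -> reflection (MRop f).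
Proof.
move=> /reflectionE fr; apply/reflectionE => x y.
by have := fr y (1 - x - y); rewrite /MRop /Mop /Rop !barycentric_rotK.
Qed.

Lemma reflectionD f g : reflection f -> reflection g ->
  reflection (fun x y => f x y + g x y).
Proof.
move=> /reflectionE fr /reflectionE gr; apply/reflectionE => x y.
by rewrite addrACA fr gr opprD.
Qed.

Lemma reflectionZ a f : reflection f -> reflection (fun x y => a * f x y).
Proof.
move=> /reflectionE fr; apply/reflectionE => x y.
by rewrite -mulrDr fr mulrN.
Qed.

Lemma reflection_R f : reflection f -> reflection (Rop f).
Proof.
move=> /reflectionE fr; apply/reflectionE => x y; rewrite /Rop -(fr y x) addrC.
by have -> : 1 - y - x = 1 - x - y by ring.
Qed.

Lemma swap_invariant_Pi f : swap_invariant f -> swap_invariant (Piop f).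
Proof.
move=> fs x y; rewrite !PiopE (fs y x) (fs x (1 - y - x)) (fs (1 - y - x) y).
have -> : 1 - y - x = 1 - x - y by ring.
by ring.
Qed.

(** Adding the relation at (x, y) and at (y, x) gives U + V = 0 by the reflection identities. The
    relation then equates [U] with its rotates, and these sum to zero, so 3 U = 0. *)
Lemma reflection_independent U V : swap_invariant U -> swap_invariant V ->
  reflection U -> reflection V ->
  (forall x y, RMop U x y + MRop V x y = 0) ->
  forall x y, U x y = 0 /\ V x y = 0.
Proof.
move=> Us Vs /reflectionE Ur /reflectionE Vr UV.
have UV0 x y : U (1 - x - y) x + V y (1 - x - y) = 0.
  by have := UV x y; rewrite RMopE.
have W0 x y : U x y + V x y = 0.
  have := UV0 x y; have := UV0 y x; have := Ur x y; have := Vr x y.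
  have -> : 1 - y - x = 1 - x - y by ring.
  by rewrite (Us (1 - x - y) y) (Vs x (1 - x - y)) => *; lra.
have U0 x y : U x y = 0.
  have := Ur x y; have := UV0 x y; have := W0 y (1 - x - y).
  have := W0 x y; have := UV0 (1 - x - y) x; rewrite !barycentric_rotK => *.
  by lra.
by move=> x y; have := W0 x y; rewrite !U0 add0r.
Qed.

End SymmetricForms.

(** * The reflection component: independence and spanning *)

Section ReflectionComponent.
Variable R : realType.
Set Implicit Arguments. Unset Strict Implicit.
Implicit Types (f g U V : R -> R -> R) (c d : nat -> R).

(* The multiplicity of the reflection representation in [Pperp n]. *)
Definition refl_mult (n : nat) : nat := (n + 2) %/ 3.

Lemma ltn_refl_mult n k : (k < refl_mult n)%N = (3 * k + 1 <= n)%N.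
Proof. by rewrite /refl_mult; apply/idP/idP; lia. Qed.

Lemma leq_double_refl_mult n k : (k < refl_mult n)%N -> (2 * k <= n)%N.
Proof. by rewrite ltn_refl_mult; lia. Qed.

Lemma sum_refl_mult n (F : nat -> R) :
  \sum_(0 <= k < n.+1 | (3 * k + 1 <= n)%N) F k = \sum_(k < refl_mult n) F k.
Proof.
have le : (refl_mult n <= n.+1)%N by rewrite /refl_mult; lia.
rewrite big_mkord (big_ord_widen n.+1 F le); apply: eq_bigl => k.
by rewrite ltn_refl_mult.
Qed.

Definition combination n c x y :=
  \sum_(k < refl_mult n) c k * Piop (bnk (R := R) n (2 * k)) x y.

Lemma Pperp_Pi n f : Pperp n f -> Pperp n (Piop f).
Proof.
move=> nf; have := PperpZ 3^-1 (PperpD (PperpD (PperpZ 2 nf)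
  (PperpZ (-1) (Pperp_MR nf))) (PperpZ (-1) (Pperp_RM nf))).
by apply: Pperp_ext => x y; rewrite /Piop; ring.
Qed.

Lemma leading_form_Pi n f H : leading_form n f H ->
  leading_form n (Piop f) (fun x y =>
    3^-1 * (2 * H x y - H y (- x - y) - H (- x - y) x)).
Proof.
move=> fH; have := leading_formZ 3^-1 (leading_formD (leading_formD (leading_formZ 2 fH)
  (leading_formZ (-1) (leading_form_MR fH))) (leading_formZ (-1) (leading_form_RM fH))).
by apply: leading_form_ext => x y; rewrite /Piop; ring.
Qed.

Lemma Pperp_combination n c : Pperp n (combination n c).
Proof.
apply: Pperp_sum => -[k klt] _; apply/PperpZ/Pperp_Pi/Pperp_bnk.
exact: leq_double_refl_mult.
Qed.

Lemma combination_Pi n c x y : combination n c x y =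
  Piop (fun x y => \sum_(k < refl_mult n) c k * bnk n (2 * k) x y) x y.
Proof.
rewrite PiopE mulr_sumr -!sumrB mulr_sumr; apply: eq_bigr => k _.
by rewrite PiopE; ring.
Qed.

Lemma swap_invariant_combination n c : swap_invariant (combination n c).
Proof.
move=> x y; apply: eq_bigr => k _; congr (_ * _); apply: swap_invariant_Pi.
by move=> a b; rewrite bnk_even_sym.
Qed.

Lemma reflection_combination n c : reflection (combination n c).
Proof.
apply/reflectionE => x y; rewrite !combination_Pi.
by have /reflectionE -> := reflection_Pi
  (fun x y => \sum_(k < refl_mult n) c k * bnk n (2 * k) x y).
Qed.

(* If the leading form of the combination vanishes, then the leading form of
   [\sum_k c k * b_{n,2k}] is invariant under the symmetries of the triangle,
   and it is divisible by [(x + y) ^ m] with [3 * m > n]. *)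
Lemma combination_leading_form_eq0 n c :
  leading_form n (combination n c) (fun _ _ => 0) ->
  forall k, (k < refl_mult n)%N -> c k = 0.
Proof.
(* [m] is the exponent of x + y in the term with the largest k, the smallest exponent that
   occurs. *)
move=> lf0 k0 k0lt; pose N := refl_mult n; pose m := (n - 2 * N.-1)%N.
have N0 : (0 < N)%N by apply: leq_ltn_trans k0lt.
have [N1 nN] : (2 * N.-1 <= n /\ 3 * N.-1 < n)%N by rewrite /N /refl_mult in N0 *; lia.
have nm : (n < 3 * m)%N by rewrite /m; lia.
pose a k := (sjacobi R (2 * (2 * k) + 1) (n - 2 * k))`_(n - 2 * k).
have a0 k : a k != 0 by have [] := sjacobi_top R (2 * (2 * k) + 1) (n - 2 * k).
pose hom k := homog (2 * k) (legendre R (2 * k)).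
pose B x y := \sum_(k < refl_mult n) c k * bnk n (2 * k) x y.
pose H x y := \sum_(k < refl_mult n) c k * (a k * ((x + y) ^+ (n - 2 * k) * hom k x y)).
pose G x y := \sum_(k < refl_mult n) c k * a k * ((x + y) ^+ (2 * (N.-1 - k)) * hom k x y).
have PB : Pdeg n B.
  by apply: Pdeg_sum => -[k klt] _; apply/PdegZ/Pdeg_bnk; exact: leq_double_refl_mult.
have BH : leading_form n B H.
  apply: leading_form_sum => -[k klt] _; apply: leading_formZ.
  by apply: leading_form_bnk; exact: leq_double_refl_mult.
have Hpi x y : 2 * H x y - H y (- x - y) - H (- x - y) x = 0.
  have lB : leading_form n (Piop B) (fun _ _ => 0).
    by apply: leading_form_ext lf0 => // ? ?; rewrite combination_Pi.
  have /eqP := leading_form_uniq (leading_form_Pi BH) lB x y.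
  by rewrite mulf_eq0 invr_eq0 pnatr_eq0 => /eqP.
(* Subtracting [Hpi] at the rotated point from [Hpi] leaves 3 H(x, y) = 3 H(y, -x-y). *)
have Hrot x y : H x y = H y (- x - y).
  have := Hpi x y; have := Hpi y (- x - y).
  have -> : - y - (- x - y) = x by ring.
  by move=> *; lra.
have Hsym : H =2 (fun x y => H y x).
  apply: (leading_form_uniq BH).
  apply: leading_form_ext (leading_form_R BH) => // x y.
  by apply: eq_bigr => k _; rewrite bnk_even_sym.
have HG x y : H x y = (x + y) ^+ m * G x y.
  rewrite mulr_sumr; apply: eq_bigr => -[k klt] _ /=.
  have kN : (k <= N.-1)%N by rewrite -ltnS prednK.
  have -> : (n - 2 * k = m + 2 * (N.-1 - k))%N by rewrite /m; lia.
  by rewrite exprD; ring.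
have PG : Pdeg n G.
  apply: Pdeg_sum => -[k klt] _; apply: PdegZ => /=.
  have kN : (k <= N.-1)%N by rewrite -ltnS prednK.
  apply: Pdeg_leq (PdegM (PdegX (2 * (N.-1 - k)) (@Pdeg_x1Dx2 R)) (Pdeg_homog (2 * k) _)).
  by lia.
have [h sh lh] := Pdeg_leading_form PB.
have hH := leading_form_uniq lh BH.
have h0 : h = 0.
  by apply: (invariant_form_eq0 sh nm PG) => x y; rewrite !hH.
have : \sum_(k < refl_mult n) (c k * a k) *: legendre R (2 * k) = 0.
  apply: poly_ext => t; rewrite horner0 horner_sum.
  (* On the line x + y = 1 with x - y = t the powers of x + y become 1, and each term is a multiple
     of the Legendre polynomial of degree 2k in t. *)
  have := hH (2^-1 * (1 + t)) (2^-1 * (1 - t)); rewrite h0 binary_form0 => e.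
  rewrite [RHS]e.
  apply: eq_bigr => k _; have xy1 : 2^-1 * (1 + t) + 2^-1 * (1 - t) = 1 by field.
  rewrite xy1 expr1n mul1r /hom homog_sum1//; last by have [] := jacobi_top R 0 0 (2 * k).
  have -> : 2^-1 * (1 + t) - 2^-1 * (1 - t) = t by field.
  by rewrite hornerZ mulrA.
move=> /(free_distinct_size (p := fun k => legendre R (2 * k)) (c := fun k => c k * a k)).
move=> /(_ (fun k => jacobi_top R 0 0 (2 * k)) k0 k0lt) /eqP.
by rewrite mulf_eq0 (negPf (a0 k0)) orbF => /eqP.
Qed.

Lemma combination_free n c : (forall x y, combination n c x y = 0) ->
  forall k, (k < refl_mult n)%N -> c k = 0.
Proof.
move=> c0; apply: (@combination_leading_form_eq0 n c).
by apply: leading_form_ext (leading_form0 n) => x y; rewrite ?c0.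
Qed.

(** Uniqueness transfers the symmetries of [f] to its leading form, and [refl_form_eq0] applies
    because n <= 3 N for N = [refl_mult n]. *)
Lemma reflection_leading_form_eq0 n f (h : {poly R}) :
  (size h <= n.+1)%N -> leading_form n f (binary_form n h) ->
  swap_invariant f -> reflection f -> (forall j, (j < refl_mult n)%N -> h`_j = 0) -> h = 0.
Proof.
move=> sh lf fs fr hlow.
have hs x y : binary_form n h x y = binary_form n h y x.
  have lR : leading_form n f (fun x y => binary_form n h y x).
    by apply: leading_form_ext (leading_form_R lf) => // a b; rewrite /Rop fs.
  exact: leading_form_uniq lf lR x y.
have hr x y : binary_form n h (- x - y) x + binary_form n h y (- x - y)
    = - binary_form n h x y.
  have lr := leading_formD (leading_form_RM lf) (leading_form_MR lf).
  have lN : leading_form n (fun x y => RMop f x y + MRop f x y)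
      (fun x y => - binary_form n h x y).
    by apply: leading_form_ext (leading_formZ (-1) lf) => a b; rewrite ?fr mulN1r.
  exact: leading_form_uniq lr lN x y.
by apply: (refl_form_eq0 (m := refl_mult n) sh) => //; rewrite /refl_mult; lia.
Qed.

(** The matrix [A] of the first N coefficients of the leading forms has trivial kernel: a
    combination lacking these coefficients has zero leading form, hence is trivial. Being square,
    [A] is invertible, so some combination matches [f] in these coefficients, and the difference has
    zero leading form. *)
Lemma swap_invariant_reflection_span n f : Pperp n f -> swap_invariant f -> reflection f ->
  exists c, forall x y, f x y = combination n c x y.
Proof.
move=> nf fs fr; pose N := refl_mult n.
have /choice[h hP] : forall k : 'I_N, exists h : {poly R}, (size h <= n.+1)%N /\
    leading_form n (Piop (bnk n (2 * k))) (binary_form n h).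
  move=> [k klt]; have [+ _] := Pperp_Pi (Pperp_bnk R (leq_double_refl_mult klt)).
  by move=> /Pdeg_leading_form[h sh lh]; exists h.
pose A := \matrix_(k < N, j < N) (h k)`_j.
(* [combination] takes a sequence over all naturals, so the row vector is extended by 0. *)
pose coefs (v : 'rV[R]_N) k := if insub k is Some i then v 0 i else 0.
have coefsE v (i : 'I_N) : coefs v i = v 0 i by rewrite /coefs valK.
have lcomb (v : 'rV[R]_N) : let H := \sum_k v 0 k *: h k in (size H <= n.+1)%N /\
    leading_form n (combination n (coefs v)) (binary_form n H).
  split.
    rewrite (leq_trans (size_sum _ _ _))//; apply/bigmax_leqP => k _.
    by rewrite (leq_trans (size_scale_leq _ _))//; have [] := hP k.
  have := @leading_form_sum R n _ (index_enum 'I_N) xpredT _ _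
    (fun k _ => leading_formZ (v 0 k) (hP k).2).
  apply: leading_form_ext => x y; first by apply: eq_bigr => k _; rewrite coefsE.
  rewrite /binary_form; under eq_bigr do rewrite mulr_sumr; rewrite exchange_big/=.
  apply: eq_bigr => i _; rewrite coef_sum !mulr_suml; apply: eq_bigr => k _.
  by rewrite coefZ; ring.
have lcoef (v : 'rV[R]_N) (j : 'I_N) : (\sum_k v 0 k *: h k)`_(val j) = (v *m A) 0 j.
  by rewrite coef_sum mxE; apply: eq_bigr => k _; rewrite coefZ mxE.
have Aunit : A \in unitmx.
  rewrite -row_free_unit; apply: inj_row_free => v vA; apply/rowP => i; rewrite mxE.
  have [sH lH] := lcomb v; rewrite -coefsE.
  apply: (@combination_leading_form_eq0 n) (ltn_ord i).
  have H0 : \sum_k v 0 k *: h k = 0.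
    apply: (reflection_leading_form_eq0 sH lH).
    - exact: swap_invariant_combination.
    - exact: reflection_combination.
    - by move=> j jN; have := lcoef v (Ordinal jN); rewrite vA mxE.
  by apply: leading_form_ext lH => // x y; rewrite H0 binary_form0.
have [k sk lk] := Pdeg_leading_form nf.1.
pose v := (\row_(j < N) k`_j) *m invmx A.
have [sH lH] := lcomb v.
exists (coefs v) => x y; apply/eqP; rewrite -subr_eq0; apply/eqP; rewrite -mulN1r.
have lD := leading_formD lk (leading_formZ (-1) lH).
pose D x y := f x y + -1 * combination n (coefs v) x y.
apply: (@Pperp_leading_form_eq0 R n D).
  exact: PperpD nf (PperpZ _ (Pperp_combination _ _)).
pose H := \sum_k v 0 k *: h k.
have lD' : leading_form n D (binary_form n (k - H)).
  apply: leading_form_ext lD => // a b.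
  rewrite /binary_form mulr_sumr -big_split; apply: eq_bigr => i _ /=.
  by rewrite coefB; ring.
have kH : k - H = 0.
  apply: (reflection_leading_form_eq0 _ lD').
  - by rewrite (leq_trans (size_polyD _ _))// size_polyN geq_max sk.
  - by move=> a b; rewrite /D fs swap_invariant_combination.
  - exact: reflectionD fr (reflectionZ _ (@reflection_combination n _)).
  - move=> j jN; rewrite coefB; have := lcoef v (Ordinal jN); rewrite -/H => ->.
    by rewrite mulmxKV// mxE subrr.
by apply: leading_form_ext lD' => // a b; rewrite kH binary_form0.
Qed.

(** Here f = S + A / 2 with [S] symmetric and [A] antisymmetric under R. The antisymmetric part is
    traded for the symmetric Q = (RM - MR) A, so the symmetric case applies to both [S] and [Q]. *)
Lemma reflection_span n f : Pperp n f -> reflection f ->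
  exists c d, forall x y,
    f x y = RMop (combination n c) x y + MRop (combination n d) x y.
Proof.
move=> nf fr.
pose S x y := 2^-1 * (f x y + Rop f x y).
pose A x y := f x y + -1 * Rop f x y.
pose Q x y := RMop A x y + -1 * MRop A x y.
have [s sE] : exists c, forall x y, S x y = combination n c x y.
  apply: swap_invariant_reflection_span.
  - exact: PperpZ (PperpD nf (Pperp_R nf)).
  - by move=> x y; rewrite /S /Rop addrC.
  - exact: reflectionZ (reflectionD fr (reflection_R fr)).
have rA : reflection A by apply: reflectionD fr (reflectionZ _ (reflection_R fr)).
have [q qE] : exists c, forall x y, Q x y = combination n c x y.
  have nA : Pperp n A by apply: PperpD nf (PperpZ _ (Pperp_R nf)).
  apply: swap_invariant_reflection_span.
  - exact: PperpD (Pperp_RM nA) (PperpZ _ (Pperp_MR nA)).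
  - move=> x y; rewrite /Q /A !RMopE /MRop /Mop /Rop.
    have -> : 1 - y - x = 1 - x - y by ring.
    by ring.
  - exact: reflectionD (reflection_RM rA) (reflectionZ _ (reflection_MR rA)).
(* On the component RM + MR = -I, so S = - RM S - MR S. Also (RM - MR)^2 = MR + RM - 2 I = -3 I, so
   A / 2 = - (RM - MR) Q / 6. *)
exists (fun k => - s k + - 6^-1 * q k), (fun k => - s k + 6^-1 * q k) => x y.
have lin b u v : combination n (fun k => - s k + b * q k) u v
    = - combination n s u v + b * combination n q u v.
  rewrite /combination mulr_sumr -sumrN -big_split.
  by apply: eq_bigr => k _ /=; ring.
have frE := (reflectionE f).1 fr.
have := frE x y; have := frE y x; have -> : 1 - y - x = 1 - x - y by ring.
rewrite RMopE /MRop /Mop /Rop !lin -!sE -!qE /S /Q /A.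
rewrite !RMopE /MRop /Mop /Rop !barycentric_rotK.
by move=> *; lra.
Qed.

End ReflectionComponent.

(* index range 0 <= k <= (n-1)/3 is encoded as (3k + 1 <= n)%N *)
Theorem theorem23 (R : realType) (n : nat) :
  (* (a) linear independence of Pi b_{n,2k} *)
  (forall c : nat -> R,
     (forall x1 x2 : R,
        \sum_(0 <= k < n.+1 | (3 * k + 1 <= n)%N)
           c k * Piop (@bnk R n (2 * k)) x1 x2 = 0) ->
     forall k, (3 * k + 1 <= n)%N -> c k = 0)
  /\
  (* (b) linear independence of {RM Pi b_{n,2k}, MR Pi b_{n,2k}} *)
  (forall c d : nat -> R,
     (forall x1 x2 : R,
        \sum_(0 <= k < n.+1 | (3 * k + 1 <= n)%N)
           (c k * RMop (Piop (@bnk R n (2 * k))) x1 x2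
            + d k * MRop (Piop (@bnk R n (2 * k))) x1 x2) = 0) ->
     forall k, (3 * k + 1 <= n)%N -> c k = 0 /\ d k = 0)
  /\
  (* ... the family lies in the tau_refl component ... *)
  (forall k, (3 * k + 1 <= n)%N ->
     tau_refl n (RMop (Piop (@bnk R n (2 * k)))) /\
     tau_refl n (MRop (Piop (@bnk R n (2 * k)))))
  /\
  (* ... and spans it *)
  (forall p : R -> R -> R, tau_refl n p ->
     exists c d : nat -> R, forall x1 x2 : R,
       p x1 x2 = \sum_(0 <= k < n.+1 | (3 * k + 1 <= n)%N)
           (c k * RMop (Piop (@bnk R n (2 * k))) x1 x2
            + d k * MRop (Piop (@bnk R n (2 * k))) x1 x2)).
Proof.
have RMMR c d x1 x2 :
    \sum_(0 <= k < n.+1 | (3 * k + 1 <= n)%N)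
      (c k * RMop (Piop (@bnk R n (2 * k))) x1 x2
       + d k * MRop (Piop (@bnk R n (2 * k))) x1 x2)
    = RMop (combination n c) x1 x2 + MRop (combination n d) x1 x2.
  (* RM and MR only substitute arguments, so they pass through the sums by computation. *)
  by rewrite sum_refl_mult big_split.
split.
  move=> c c0 k kn; apply: (@combination_free R n c); last by rewrite ltn_refl_mult.
  by move=> x y; rewrite -(c0 x y) sum_refl_mult.
split.
  move=> c d cd0 k kn.
  (* The two combinations are separated first; the independence of (a) then applies to each. *)
  have UV0 : forall x y, combination n c x y = 0 /\ combination n d x y = 0.
    apply: reflection_independent.
    - exact: swap_invariant_combination.
    - exact: swap_invariant_combination.
    - exact: reflection_combination.
    - exact: reflection_combination.
    - by move=> x y; rewrite -RMMR cd0.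
  by split; [apply: (@combination_free R n c)|apply: (@combination_free R n d)];
    rewrite ?ltn_refl_mult// => x y; have [] := UV0 x y.
split.
  move=> k kn; have nu : Pperp n (Piop (@bnk R n (2 * k))).
    by apply/Pperp_Pi/Pperp_bnk/leq_double_refl_mult; rewrite ltn_refl_mult.
  have ru := @reflection_Pi R (@bnk R n (2 * k)).
  split; split.
  - exact: Pperp_RM.
  - exact: reflection_RM.
  - exact: Pperp_MR.
  - exact: reflection_MR.
move=> p [np rp]; have [c [d pE]] := reflection_span np rp.
by exists c, d => x1 x2; rewrite RMMR pE.
Qed.
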